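(* Let $p\ge2$ and $1\le r\le p$ be integers. There exists a positive probability measure $\mu_{p,r}$ on $[0,K_p]$, $K_p=p^p(p-1)^{1-p}$, whose Cauchy transform $G_{p,r}$ is algebraic, and these measures are such that, if $u=zG_{p,1}(z)$, then $$u^p-zu+z=0,\qquad u^r=zG_{p,r}(z).$$ Thus $G_{p,r}$ is annihilated by $$\mathcal R_{p,r}(z,w)=\operatorname{Res}_u\bigl(u^p-zu+z,\ u^r-zw\bigr),$$ i.e. $\mathcal R_{p,r}(z,G_{p,r}(z))=0$, and the irreducible factor of $\mathcal R_{p,r}$ containing the probability branch $G_{p,r}(z)=z^{-1}+O(z^{-2})$ admits the positive mother-body measure $\mu_{p,r}$.
   Context: For a finite compactly supported measure $\mu$ on $\mathbb C$, its Cauchy transform is $\mathcal C_\mu(z)=\int_{\mathbb C}\frac{d\mu(\zeta)}{z-\zeta}$, so $G_{p,r}=\mathcal C_{\mu_{p,r}}$. $\operatorname{Res}_u$ denotes the resultant with respect to $u$. A positive mother-body measure for a germ $f(z)=a_0/z+O(z^{-2})$, $a_0>0$, with irreducible defining polynomial $P$ (i.e. $P$ irreducible, $P(z,f(z))=0$ near infinity) is a positive compactly supported measure whose Cauchy transform has germ $f$ at infinity, whose support is a finite union of compact semi-analytic arcs and isolated points, and whose Cauchy transform is a branch of $P(z,w)=0$ in every component of the complement of the support. Here $P$ is the irreducible factor of $\mathcal R_{p,r}$ vanishing on $w=G_{p,r}(z)$. *)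

(* Defs.v *)
From HB Require Import structures.
From mathcomp Require Import all_boot all_order all_algebra.
From mathcomp Require Import complex.
From mathcomp Require Import all_classical all_reals all_analysis.

Set Implicit Arguments.
Unset Strict Implicit.
Unset Printing Implicit Defensive.

Import Order.TTheory GRing.Theory Num.Theory.
Import numFieldNormedType.Exports.

Local Open Scope classical_set_scope.
Local Open Scope complex_scope.
Local Open Scope ring_scope.

(* The libraries put no topology on R[i] itself; it gets that of R[i]^o, i.e.
   the topology of the modulus, seen as a normed space over R[i]. In particular
   [derivable f z 1] for f : R[i] -> R[i] is complex differentiability. *)
HB.instance Definition _ (R : realType) := NormedModule.copy R[i] R[i]^o.

Definition borelC (R : realType) := g_sigma_algebraType (@open R[i]).

Section measures_on_C.
Variable R : realType.
Implicit Types (mu : {measure set (borelC R) -> \bar R}) (z : R[i]).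

Definition msupport mu : set R[i] :=
  [set z | forall U : set R[i], open U -> U z -> (0 < mu U)%E].

(* Integral of 1 / (z - zeta), real and imaginary parts separately. *)
Definition cauchy_transform mu z : R[i] :=
  (\int[mu]_zeta complex.Re (z - (zeta : R[i]))^-1) +i*
  (\int[mu]_zeta complex.Im (z - (zeta : R[i]))^-1).

End measures_on_C.

Section semianalytic.
Variable R : realType.
Implicit Types (f : R[i] -> R) (a z : R[i]) (A : set R[i]).

(* Real-analyticity on C = R^2: f is near a the sum of a power series in
   (x, y) = (Re, Im); the bound on the coefficients makes the double series
   absolutely convergent on the polydisc of radius rho. *)
Definition real_analytic_at f a : Prop :=
  exists (c : nat -> nat -> R) (rho M : R),
    [/\ 0 < rho,
        forall i j, `|c i j| * rho ^+ (i + j) <= M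
      & forall x y : R, `|x| < rho -> `|y| < rho ->
          (fun n => \sum_(i < n) \sum_(j < n) c i j * x ^+ i * y ^+ j) @ \oo
            --> f (a + (x +i* y))].

Definition real_analytic_on (U : set R[i]) f : Prop :=
  forall a, U a -> real_analytic_at f a.

(* Every point of C (not only of A) has a neighbourhood U on which A is a
   finite union of finite intersections of sets {f = 0} or {f > 0}, with f
   real-analytic on U; [s k l] selects the equation or the inequality. *)
Definition semianalytic A : Prop :=
  forall a, exists (U : set R[i]) (m n : nat)
      (f : 'I_m -> 'I_n -> R[i] -> R) (s : 'I_m -> 'I_n -> bool),
    [/\ open U, U a,
        forall k l, real_analytic_on U (f k l)
      & A `&` U = [set z | U z /\ exists k, forall l,
                     if s k l then f k l z = 0 else 0 < f k l z]].

Definition semianalytic_arc A : Prop :=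
  semianalytic A /\
  exists gamma : R -> R[i],
    [/\ {within `[0, 1], continuous gamma},
        {in `[0, 1] &, injective gamma}
      & A = gamma @` `[0, 1]].

Definition arcs_and_isolated_points A : Prop :=
  exists (n : nat) (arc : 'I_n -> set R[i]) (pts : seq R[i]),
    [/\ forall k, semianalytic_arc (arc k),
        [set` pts] `<=` isolated A
      & A = \bigcup_k arc k `|` [set` pts]].

End semianalytic.

(* C[z, w] is {poly {poly R[i]}} with z the outer and w the inner variable, so
   that [P.[z, w]] evaluates P at (z, w). *)
Section plane_curves.
Variable R : realType.
Implicit Types (P Q : {poly {poly R[i]}}) (f : R[i] -> R[i]).

(* [irreducible_poly] is irreducibility over a field of coefficients; here
   irreducibility in the ring C[z, w] is meant. *)
Definition irreducible2 P : Prop :=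
  [/\ P != 0, P \isn't a GRing.unit
    & forall A B : {poly {poly R[i]}},
        P = A * B -> A \is a GRing.unit \/ B \is a GRing.unit].

Definition divides2 P Q : Prop := exists A, Q = P * A.

Definition algebraic_on (D : set R[i]) f : Prop :=
  exists2 P : {poly {poly R[i]}}, P != 0 & forall z, D z -> P.[z, f z] = 0.

Definition near_infinity (S : R[i] -> Prop) : Prop :=
  exists M : R, forall z, M%:C < `|z| -> S z.

(* f z = a / z + O (z ^ -2) at infinity *)
Definition leading_term (f : R[i] -> R[i]) (a : R) : Prop :=
  exists c : R, near_infinity (fun z => `|f z - a%:C / z| <= c%:C / `|z| ^+ 2).

Definition branch (D : set R[i]) P f : Prop :=
  forall z, D z -> derivable f z 1 /\ P.[z, f z] = 0.

Definition positive_germ f : Prop :=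
  near_infinity (fun z => derivable f z 1) /\
  exists2 a : R, 0 < a & leading_term f a.

Definition defining_polynomial f P : Prop :=
  irreducible2 P /\ near_infinity (fun z => P.[z, f z] = 0).

Definition positive_mother_body f P
    (mu : {finite_measure set (borelC R) -> \bar R}) : Prop :=
  [/\ positive_germ f, defining_polynomial f P &
   [/\ compact (msupport mu),
       near_infinity (fun z => cauchy_transform mu z = f z),
       arcs_and_isolated_points (msupport mu)
     & forall x, (~` msupport mu) x ->
         branch (connected_component (~` msupport mu) x) P
           (cauchy_transform mu)]].

End plane_curves.

Section raney.
Variable R : realType.

Definition Kedge (p : nat) : R := p%:R ^+ p / (p.-1)%:R ^+ p.-1.

Definition segment (p : nat) : set R[i] :=
  [set x%:C | x in `[0, Kedge p]].

(* Res_u (u ^ p - z u + z, u ^ r - z w): the variable u is the 'X of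
   {poly {poly {poly R[i]}}}, with coefficients in C[z, w]. *)
Definition raney_resultant (p r : nat) : {poly {poly R[i]}} :=
  let z : {poly {poly R[i]}} := 'X in
  let w : {poly {poly R[i]}} := 'X%:P in
  resultant ('X^p - z%:P * 'X + z%:P) ('X^r - (z * w)%:P).

End raney.

Arguments Kedge : clear implicits.
Arguments segment : clear implicits.
Arguments raney_resultant : clear implicits.

(* Main.v *)
(** Write p = m + 1 and x(u) = u ^ p / (u - 1), so that u ^ p - z u + z = 0 means
    z = x(u).  For t in [-pi/p, pi/p] the points

      u(t) = sin (p t) / sin (m t) * exp (i t) = 1 + sin t / sin (m t) * exp (i p t)

    form a closed curve through 0 on which x is real: x(u(t)) is even in t and
    decreases from K_p at t = 0 to 0 at t = pi/p.  The measure mu_{p,r} is the image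
    under x(u(t)) of the density - Im (u ^ r x'/x) / (2 pi), which is nonnegative
    because x'/x = - sin t * (p ^ 2 + q ^ 2) / (sin (p t) / sin (m t)) with q real.

    For z off [0, K_p] let a_1, ..., a_p be the roots of u ^ p - z u + z.  Since

      z x' / (x (z - x)) = p u'/u - sum_k u' / (u - a_k),

    integrating u ^ r times this along the curve gives z G_{p,r}(z) = sum_k n_k a_k ^ r,
    where n_k is the winding number of the curve around a_k.  The curve is star-shaped
    with respect to 0, hence n_k is 0 or 1; and sum_k n_k is the winding number around
    1, that is 1, because d log (z - x) integrates to 0 (x runs from 0 to K_p and back).
    So exactly one root u has n_k = 1, and z G_{p,r}(z) = u ^ r for all r at once.

    No analytic continuation is needed for the defining polynomials: along the branch,
    z and G_{p,r}(z) are rational functions of u, so that P(z, G_{p,r}(z)) vanishes as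
    soon as a polynomial in the single variable u has infinitely many roots. *)
Require Import Defs.
From HB Require Import structures.
From mathcomp Require Import all_boot all_order all_algebra.
From mathcomp Require Import complex.
From mathcomp Require Import all_classical all_reals all_analysis.
From mathcomp Require Import measurable_realfun zify ring lra.

Set Implicit Arguments.
Unset Strict Implicit.
Unset Printing Implicit Defensive.

Import Order.TTheory GRing.Theory Num.Theory.
Import numFieldNormedType.Exports.

Local Open Scope classical_set_scope.
Local Open Scope complex_scope.
Local Open Scope ring_scope.

(** * Complex functions of a real variable *)

Section complex_calculus.
Variable R : realType.
Local Notation Re := (@complex.Re R).
Local Notation Im := (@complex.Im R).
Implicit Types (f g : R -> R[i]) (x a b : R) (d e c z : R[i]).

Lemma ReD z c : Re (z + c) = Re z + Re c.
Proof. by case: z c => ? ? []. Qed.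

Lemma ImD z c : Im (z + c) = Im z + Im c.
Proof. by case: z c => ? ? []. Qed.

Lemma ReN z : Re (- z) = - Re z. Proof. by case: z. Qed.

Lemma ImN z : Im (- z) = - Im z. Proof. by case: z. Qed.

Lemma ReM z c :
  Re (z * c) = Re z * Re c - Im z * Im c.
Proof. by case: z c => ? ? []. Qed.

Lemma ImM z c :
  Im (z * c) = Re z * Im c + Im z * Re c.
Proof. by case: z c => ? ? []. Qed.

Lemma ReV z : Re z^-1 =
  Re z / (Re z ^+ 2 + Im z ^+ 2).
Proof. by case: z. Qed.

Lemma ImV z : Im z^-1 =
  - Im z / (Re z ^+ 2 + Im z ^+ 2).
Proof. by case: z => ? ? /=; rewrite mulNr. Qed.

Definition ReImE := (ReD, ImD, ReN, ImN, ReM, ImM, ReV, ImV).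

Lemma complexP z c :
  Re z = Re c -> Im z = Im c -> z = c.
Proof. by case: z c => ? ? [? ?] /= -> ->. Qed.

Lemma sqr_ReIm_neq0 z : z != 0 -> Re z ^+ 2 + Im z ^+ 2 != 0.
Proof.
apply: contra; rewrite paddr_eq0 ?sqr_ge0// !sqrf_eq0 => /andP[/eqP u /eqP v].
by apply/eqP/complexP.
Qed.

(** Differentiation in a real variable is taken on the two components, so that every rule comes down
    to those for real functions. *)
Definition is_cderive f x d :=
  is_derive x 1 (Re \o f) (Re d) /\
  is_derive x 1 (Im \o f) (Im d).

Definition ccontinuous_at f x :=
  {for x, continuous (Re \o f)} /\ {for x, continuous (Im \o f)}.

Lemma is_derive_continuous (h : R -> R) x (l : R) :
  is_derive x 1 h l -> {for x, continuous h}.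
Proof.
move=> hl; apply: (@differentiable_continuous _ R^o R^o).
by apply/derivable1_diffP; case: hl.
Qed.

Lemma is_cderive_continuous f x d : is_cderive f x d -> ccontinuous_at f x.
Proof. by case=> fr fi; split; [apply: is_derive_continuous fr|apply: is_derive_continuous fi]. Qed.

Lemma is_cderive_eq f x d e : is_cderive f x d -> d = e -> is_cderive f x e.
Proof. by move=> ? <-. Qed.

Lemma is_cderive_ext f g x d : f =1 g -> is_cderive f x d -> is_cderive g x d.
Proof. by move=> /funext ->. Qed.

Lemma is_cderive_cst c x : is_cderive (fun=> c) x 0.
Proof. by split; exact: is_derive_cst. Qed.

Lemma is_cderiveD f g x d e : is_cderive f x d -> is_cderive g x e ->
  is_cderive (fun t => f t + g t) x (d + e).
Proof.
move=> [fr fi] [gr gi]; split.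
- rewrite [_ \o _](_ : _ = (Re \o f) + (Re \o g)).
    by rewrite ReD; exact: is_deriveD.
  by apply/funext => t /=; rewrite ReD.
- rewrite [_ \o _](_ : _ = (Im \o f) + (Im \o g)).
    by rewrite ImD; exact: is_deriveD.
  by apply/funext => t /=; rewrite ImD.
Qed.

Lemma is_cderiveM f g x d e : is_cderive f x d -> is_cderive g x e ->
  is_cderive (fun t => f t * g t) x (d * g x + f x * e).
Proof.
move=> [fr fi] [gr gi]; split.
- rewrite [_ \o _](_ : _ = (Re \o f) * (Re \o g)
                         - (Im \o f) * (Im \o g)).
    apply: (is_derive_eq (is_deriveB (is_deriveM fr gr) (is_deriveM fi gi))).
    by rewrite !ReImE /= /GRing.scale/=; ring.
  by apply/funext => t /=; rewrite ReM.
- rewrite [_ \o _](_ : _ = (Re \o f) * (Im \o g)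
                         + (Im \o f) * (Re \o g)).
    apply: (is_derive_eq (is_deriveD (is_deriveM fr gi) (is_deriveM fi gr))).
    by rewrite !ReImE /= /GRing.scale/=; ring.
  by apply/funext => t /=; rewrite ImM.
Qed.

Lemma is_cderiveZ c f x d : is_cderive f x d ->
  is_cderive (fun t => c * f t) x (c * d).
Proof.
move=> fd; apply: is_cderive_eq (is_cderiveM (is_cderive_cst c x) fd) _.
by rewrite mul0r add0r.
Qed.

Lemma is_cderiveX f x d n : is_cderive f x d ->
  is_cderive (fun t => f t ^+ n) x (n%:R * f x ^+ n.-1 * d).
Proof.
move=> fd; elim: n => [|n ih].
  by rewrite !mul0r; apply: is_cderive_ext (is_cderive_cst 1 x) => t; rewrite expr0.
apply: (is_cderive_ext (f := fun t => f t * f t ^+ n)).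
  by move=> t; rewrite exprS.
apply: is_cderive_eq (is_cderiveM fd ih) _.
case: n {ih} => [|n] /=; first by rewrite !mul0r mulr0 expr0; ring.
by rewrite [f x ^+ n.+1]exprS -[n.+2%:R]natr1; ring.
Qed.

Lemma ccontinuous_cst c x : ccontinuous_at (fun=> c) x.
Proof. exact: is_cderive_continuous (is_cderive_cst c x). Qed.

Lemma ccontinuousD f g x : ccontinuous_at f x -> ccontinuous_at g x ->
  ccontinuous_at (fun t => f t + g t) x.
Proof.
move=> [fr fi] [gr gi]; split.
- rewrite [_ \o _](_ : _ = (Re \o f) \+ (Re \o g)).
    exact: continuousD.
  by apply/funext => t /=; rewrite ReD.
- rewrite [_ \o _](_ : _ = (Im \o f) \+ (Im \o g)).
    exact: continuousD.
  by apply/funext => t /=; rewrite ImD.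
Qed.

Lemma ccontinuousM f g x : ccontinuous_at f x -> ccontinuous_at g x ->
  ccontinuous_at (fun t => f t * g t) x.
Proof.
move=> [fr fi] [gr gi]; split.
- rewrite [_ \o _](_ : _ = ((Re \o f) \* (Re \o g))
                         \- ((Im \o f) \* (Im \o g))).
    by apply: continuousB; exact: continuousM.
  by apply/funext => t /=; rewrite ReM.
- rewrite [_ \o _](_ : _ = ((Re \o f) \* (Im \o g))
                         \+ ((Im \o f) \* (Re \o g))).
    by apply: continuousD; exact: continuousM.
  by apply/funext => t /=; rewrite ImM.
Qed.

Lemma ccontinuousN f x : ccontinuous_at f x -> ccontinuous_at (fun t => - f t) x.
Proof.
move=> [fr fi]; split.
- rewrite [_ \o _](_ : _ = \- (Re \o f)); first exact: continuousN.
  by apply/funext => t /=; rewrite ReN.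
- rewrite [_ \o _](_ : _ = \- (Im \o f)); first exact: continuousN.
  by apply/funext => t /=; rewrite ImN.
Qed.

Lemma ccontinuousX f x n : ccontinuous_at f x ->
  ccontinuous_at (fun t => f t ^+ n) x.
Proof.
move=> fc; elim: n => [|n ih].
  rewrite (_ : (fun _ => _) = fun=> 1); first exact: ccontinuous_cst.
  by apply/funext => t; rewrite expr0.
rewrite (_ : (fun _ => _) = fun t => f t * f t ^+ n).
  exact: ccontinuousM.
by apply/funext => t; rewrite exprS.
Qed.

Lemma ccontinuousV f x : f x != 0 -> ccontinuous_at f x ->
  ccontinuous_at (fun t => (f t)^-1) x.
Proof.
move=> /sqr_ReIm_neq0 n0 [fr fi].
pose n t := Re (f t) * Re (f t) + Im (f t) * Im (f t).
have nV : {for x, continuous (fun t => (n t)^-1)}.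
  apply: (@continuousV _ _ n); first by rewrite /n -!expr2.
  by apply: continuousD; exact: continuousM.
split.
- rewrite [_ \o _](_ : _ = (Re \o f) \* (fun t => (n t)^-1)).
    exact: continuousM.
  by apply/funext => t /=; rewrite ReV /n -!expr2.
- rewrite [_ \o _](_ : _ = (\- (Im \o f)) \* (fun t => (n t)^-1)).
    by apply: continuousM; [exact: continuousN|exact: nV].
  by apply/funext => t /=; rewrite ImV /n -!expr2.
Qed.

End complex_calculus.

(** * Integrals of complex functions of a real variable *)

Section complex_integral.
Variable R : realType.
Local Notation Re := (@complex.Re R).
Local Notation Im := (@complex.Im R).
Local Notation leb := (@lebesgue_measure R).
Implicit Types (f g : R -> R[i]) (h : R -> R) (x a b : R) (d e c z : R[i]).

Lemma continuous_on_segment_integrable h a b :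
  (forall t, a <= t <= b -> {for t, continuous h}) ->
  leb.-integrable `[a, b] (EFin \o h).
Proof.
move=> hc; apply: continuous_compact_integrable; first exact: segment_compact.
apply: continuous_in_subspaceT => t; rewrite inE /= in_itv/= => /hc.
exact.
Qed.

Lemma Rintegral_derive h (H : R -> R) a b : a <= b ->
  (forall t, a <= t <= b -> is_derive t 1 H (h t)) ->
  (forall t, a <= t <= b -> {for t, continuous h}) ->
  \int[leb]_(t in `[a, b]) h t = H b - H a.
Proof.
(* A one-point interval is treated apart, since [continuous_FTC2] needs a < b. *)
rewrite le_eqVlt => /predU1P[<- _ _|ab Hh hc].
  by rewrite set_itv1 Rintegral_set1 subrr.
have Hc t : a <= t <= b -> {for t, continuous H}.
  by move=> /Hh; exact: is_derive_continuous.
rewrite /Rintegral (@continuous_FTC2 _ h H)//.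
- apply: continuous_in_subspaceT => t; rewrite inE /= in_itv/= => /hc.
  exact.
- split.
  + by move=> t; rewrite in_itv/= => /andP[/ltW at_ /ltW tb]; have [] := Hh t; rewrite ?at_.
  + by apply: cvg_at_right_filter; apply: Hc; rewrite lexx ltW.
  + by apply: cvg_at_left_filter; apply: Hc; rewrite lexx ltW.
- move=> t; rewrite in_itv/= => /andP[/ltW at_ /ltW tb].
  by rewrite derive1E; have [] := Hh t; rewrite ?at_.
Qed.

Definition cintegral a b f : R[i] :=
  (\int[leb]_(t in `[a, b]) Re (f t)) +i* (\int[leb]_(t in `[a, b]) Im (f t)).

Definition ccontinuous_on a b f := forall t, a <= t <= b -> ccontinuous_at f t.

Lemma ccontinuous_on_integrable a b f : ccontinuous_on a b f ->
  leb.-integrable `[a, b] (EFin \o (Re \o f)) /\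
  leb.-integrable `[a, b] (EFin \o (Im \o f)).
Proof. by move=> fc; split; apply: continuous_on_segment_integrable => t /fc[]. Qed.

Lemma eq_cintegral a b f g : (forall t, a <= t <= b -> f t = g t) ->
  cintegral a b f = cintegral a b g.
Proof.
move=> fg; congr (_ +i* _); apply: eq_Rintegral => t; rewrite inE/= in_itv/=;
  by move=> /fg ->.
Qed.

Lemma cintegral_derive f F a b : a <= b ->
  (forall t, a <= t <= b -> is_cderive F t (f t)) -> ccontinuous_on a b f ->
  cintegral a b f = F b - F a.
Proof.
move=> ab Ff fc; apply: complexP; rewrite !ReImE /=.
- by apply: (@Rintegral_derive _ (Re \o F)) => // t tab; [have [] := Ff t tab|have [] := fc t tab].
- by apply: (@Rintegral_derive _ (Im \o F)) => // t tab; [have [] := Ff t tab|have [] := fc t tab].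
Qed.

Lemma cintegral0 a b : cintegral a b (fun=> 0) = 0.
Proof.
by apply: complexP => /=; rewrite Rintegral_cst// mul0r.
Qed.

Lemma cintegralD a b f g : ccontinuous_on a b f -> ccontinuous_on a b g ->
  cintegral a b (fun t => f t + g t) = cintegral a b f + cintegral a b g.
Proof.
move=> /ccontinuous_on_integrable[fr fi] /ccontinuous_on_integrable[gr gi].
apply: complexP; rewrite !ReImE /= -RintegralD//; apply: eq_Rintegral => t _;
  by rewrite !ReImE.
Qed.

Lemma cintegralZ a b c f : ccontinuous_on a b f ->
  cintegral a b (fun t => c * f t) = c * cintegral a b f.
Proof.
move=> /ccontinuous_on_integrable[fr fi].
have ir k : leb.-integrable `[a, b] (EFin \o (fun t => k * Re (f t))).
  exact: (integrableZl _ _ fr).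
have ii k : leb.-integrable `[a, b] (EFin \o (fun t => k * Im (f t))).
  exact: (integrableZl _ _ fi).
apply: complexP; rewrite !ReImE /= -!RintegralZl//.
- by rewrite -RintegralB//; apply: eq_Rintegral => t _; rewrite ReM.
- by rewrite -RintegralD//; apply: eq_Rintegral => t _; rewrite ImM.
Qed.

Lemma cintegralN a b f : ccontinuous_on a b f ->
  cintegral a b (fun t => - f t) = - cintegral a b f.
Proof.
move=> fc; rewrite -mulN1r -cintegralZ//.
by apply: eq_cintegral => t _; rewrite mulN1r.
Qed.

Lemma ccontinuous_on_sum (I : eqType) (s : seq I) (F : I -> R -> R[i]) a b :
  (forall i, i \in s -> ccontinuous_on a b (F i)) ->
  ccontinuous_on a b (fun t => \sum_(i <- s) F i t).
Proof.
elim: s => [|i s ih] Fc t tab.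
  rewrite (_ : (fun _ => _) = fun=> 0); first exact: ccontinuous_cst.
  by apply/funext => u; rewrite big_nil.
rewrite (_ : (fun _ => _) = fun t => F i t + \sum_(j <- s) F j t).
  apply: ccontinuousD; first by apply: Fc => //; rewrite mem_head.
  by apply: ih => // j js; apply: Fc; rewrite inE js orbT.
by apply/funext => u; rewrite big_cons.
Qed.

Lemma cintegral_sum (I : eqType) (s : seq I) (F : I -> R -> R[i]) a b :
  (forall i, i \in s -> ccontinuous_on a b (F i)) ->
  cintegral a b (fun t => \sum_(i <- s) F i t) = \sum_(i <- s) cintegral a b (F i).
Proof.
elim: s => [|i s ih] Fc.
  by rewrite big_nil -[RHS](cintegral0 a b); apply: eq_cintegral => t _; rewrite big_nil.
have Fs j : j \in s -> ccontinuous_on a b (F j).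
  by move=> js; apply: Fc; rewrite inE js orbT.
rewrite big_cons -(ih Fs) -cintegralD.
- by apply: eq_cintegral => t _; rewrite big_cons.
- by apply: Fc; rewrite mem_head.
- exact: ccontinuous_on_sum.
Qed.

Lemma cintegral_split a b x f : a <= x <= b -> ccontinuous_on a b f ->
  cintegral a b f = cintegral a x f + cintegral x b f.
Proof.
move=> /andP[ax xb] /ccontinuous_on_integrable[fr fi].
have aux h : leb.-integrable `[a, b] (EFin \o h) ->
    \int[leb]_(t in `[a, b]) h t
    = \int[leb]_(t in `[a, x]) h t + \int[leb]_(t in `[x, b]) h t.
  move=> ih; apply/eqP; rewrite addrC -subr_eq Rintegral_itvB ?bnd_simp//.
  rewrite Rintegral_itv_obnd_cbnd//; apply: integrableS ih => //.
  by apply: subset_itv; rewrite bnd_simp.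
by apply: complexP; rewrite !ReImE /=; apply: aux.
Qed.

(** The substitution t -> -t shows that the integral equals its own opposite. *)
Lemma Rintegral_odd h a : 0 <= a ->
  (forall t, - a <= t <= a -> {for t, continuous h}) ->
  (forall t, h (- t) = - h t) ->
  \int[leb]_(t in `[- a, a]) h t = 0.
Proof.
move=> a0 hc ho.
have ih := continuous_on_segment_integrable hc.
have : \int[leb]_(t in `[- a, a]) h t = \int[leb]_(t in `[- a, a]) (h (- t)).
  rewrite /Rintegral; congr fine.
  have := @integration_by_substitution_oppr _ h (- a) a; rewrite opprK; apply.
  - by rewrite ge0_cp.
  - apply: continuous_in_subspaceT => t; rewrite inE /= in_itv/= => /hc.
    exact.
rewrite [RHS](@eq_Rintegral _ _ _ leb _ (fun t => (-1) * h t)).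
  by rewrite RintegralZl// mulN1r => /eqP; rewrite -subr_eq0 opprK -mulr2n mulrn_eq0 => /eqP.
by move=> t _; rewrite ho mulN1r.
Qed.

Lemma cintegral_odd f a : 0 <= a -> ccontinuous_on (- a) a f ->
  (forall t, f (- t) = - f t) -> cintegral (- a) a f = 0.
Proof.
move=> a0 fc fo; apply: complexP; (apply: Rintegral_odd => // t; first by move=> /fc[]);
  by rewrite fo !ReImE.
Qed.

End complex_integral.

(** * Logarithm and winding numbers *)

Section complex_logarithm.
Variable R : realType.
Local Notation Re := (@complex.Re R).
Local Notation Im := (@complex.Im R).
Local Notation leb := (@lebesgue_measure R).
Implicit Types (f g u : R -> R[i]) (h : R -> R) (x a b : R) (d e c z w : R[i]).

Definition sqr_modulus z := Re z ^+ 2 + Im z ^+ 2.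

(** Written through [expR] and [ln], it is differentiated by the chain rule and is positive for
    every z; at 0 it is therefore not the true modulus. *)
Definition modulus z := expR (ln (sqr_modulus z) / 2).

(* The half-angle formula makes the argument smooth on the whole slit plane. *)
Definition clog z : R[i] :=
  (ln (sqr_modulus z) / 2) +i* (2 * atan (Im z / (modulus z + Re z))).

Lemma sqr_modulus_gt0 z : z != 0 -> 0 < sqr_modulus z.
Proof.
by move=> /sqr_ReIm_neq0 z0; rewrite lt_def z0 addr_ge0// sqr_ge0.
Qed.

Lemma modulus_gt0 z : 0 < modulus z. Proof. exact: expR_gt0. Qed.

Lemma sqr_modulusE z : z != 0 -> modulus z ^+ 2 = sqr_modulus z.
Proof.
move=> /sqr_modulus_gt0 z0; rewrite /modulus -expRM_natl.
by rewrite mulrCA divff ?pnatr_eq0// mulr1 lnK.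
Qed.

(* C minus the half-line ]-oo, 0]. *)
Definition slit z := (Im z == 0) ==> (0 < Re z).

Lemma slit_neq0 z : slit z -> z != 0.
Proof. by apply: contraL => /eqP ->; rewrite /slit /= eqxx ltxx. Qed.

(** Off the real line, the product of modulus - Re and modulus + Re is the square of Im, hence
    positive, which excludes modulus + Re <= 0. This quantity is the denominator in [clog]. *)
Lemma slit_gt0 z : slit z -> 0 < modulus z + Re z.
Proof.
move=> sz; have z0 := slit_neq0 sz; have m0 := modulus_gt0 z.
have m2 := sqr_modulusE z0; move: sz; rewrite /slit.
have [iz /= rz|iz _] := eqVneq (Im z) 0; first by rewrite addr_gt0.
have : 0 < modulus z ^+ 2 - Re z ^+ 2.
  by rewrite m2 /sqr_modulus addrC addrA addNr add0r lt_def sqrf_eq0 iz sqr_ge0.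
rewrite subr_sqr => h; have [//|m1] := ltP 0 (modulus z + Re z).
have : 0 < modulus z - Re z by lra.
move=> /pmulr_rgt0 h2; move: h; rewrite h2 => h.
by rewrite ltNge m1 in h.
Qed.

(** A quarter turn carries the closed lower half-plane to the closed right half-plane, which meets
    the cut only at 0. With [slit_NiM] for the upper half-plane, a curve staying in one half-plane
    has a logarithm even if it touches the negative axis. *)
Lemma slit_iM z : z != 0 -> Im z <= 0 -> slit ('i%C * z).
Proof.
case: z => X Y; rewrite eq_complex /slit /= => z0 Y0.
rewrite !mul0r !mul1r add0r sub0r oppr_gt0; apply/implyP => /eqP X0.
by move: z0; rewrite X0 eqxx /= lt_neqAle Y0 => ->.
Qed.

Lemma slit_NiM z : z != 0 -> 0 <= Im z -> slit (- 'i%C * z).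
Proof.
move=> z0 Y0; rewrite mulNr -mulrN; apply: slit_iM; first by rewrite oppr_eq0.
by rewrite ImN oppr_le0.
Qed.

Lemma is_cderive_clog f x d : slit (f x) -> is_cderive f x d ->
  is_cderive (fun t => clog (f t)) x (d / f x).
Proof.
move=> sf [fr fi]; have f0 := slit_neq0 sf.
have n0 := sqr_modulus_gt0 f0; have n1 := lt0r_neq0 n0.
have mR := slit_gt0 sf; have mR0 := lt0r_neq0 mR.
have m0 := lt0r_neq0 (modulus_gt0 (f x)).
have m2 := sqr_modulusE f0.
pose n t := sqr_modulus (f t).
pose n' := 2 * (Re (f x) * Re d + Im (f x) * Im d).
have dn : is_derive x 1 n n'.
  apply: (is_derive_eq (is_deriveD (is_deriveX 2 fr) (is_deriveX 2 fi))).
  by rewrite /GRing.scale/= /n'; ring.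
have dl : is_derive x 1 (fun t => ln (n t) / 2) (n' / n x / 2).
  have h : is_derive x 1 (@ln R \o n) ((n x)^-1 * n').
    by apply: is_derive1_comp; exact: is_derive1_ln.
  rewrite (_ : (fun _ => _) = 2^-1 \*: (@ln R \o n)).
    by apply: is_derive_eq; rewrite /GRing.scale/=; ring.
  by apply/funext => t; rewrite /= /GRing.scale/= mulrC.
have dm : is_derive x 1 (fun t => modulus (f t)) (modulus (f x) * (n' / n x / 2)).
  exact: (@is_derive1_comp _ (@expR R) (fun t => ln (n t) / 2)).
split.
- apply: is_derive_eq dl _.
  rewrite ReM ReV ImV -/(sqr_modulus (f x)) /n' /n.
  by field.
- pose q t := Im (f t) / (modulus (f t) + Re (f t)).
  pose s t := (modulus (f t) + Re (f t))^-1.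
  have ds : is_derive x 1 s
      (- (modulus (f x) + Re (f x)) ^- 2 *: (modulus (f x) * (n' / n x / 2) + Re d)).
    by apply: (@is_deriveV _ (fun t => modulus (f t) + Re (f t))) => //; exact: is_deriveD.
  have dq : is_derive x 1 q _ := is_deriveM fi ds.
  have da : is_derive x 1 (@atan R \o q) _ := is_derive1_comp (is_derive1_atan (q x)) dq.
  rewrite (_ : Im \o _ = 2 \*: (@atan R \o q))//.
  apply: is_derive_eq; rewrite /GRing.scale/= ImM ReV ImV.
  rewrite -/(sqr_modulus (f x)) /n' /n /q /s -m2.
  have hm : Im (f x) ^+ 2 = modulus (f x) ^+ 2 - Re (f x) ^+ 2.
    by rewrite m2 /sqr_modulus addrC addKr.
  (* The denominator in the derivative of [atan], with Im ^ 2 replaced by modulus ^ 2 - Re ^ 2. *)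
  have q1 : 1 + (Im (f x) / (modulus (f x) + Re (f x))) ^+ 2
      = 2 * modulus (f x) / (modulus (f x) + Re (f x)).
    by rewrite expr_div_n hm; field.
  rewrite q1.
  move: (modulus (f x)) (Re (f x)) (Im (f x)) (Re d) (Im d) mR0 m0 hm.
  move=> m X Y dX dY mX m0' hm.
  (* The two sides differ by a multiple of m ^ 2 - X ^ 2 - Y ^ 2, made explicit here; [hm] cancels
     it. *)
  transitivity (dX * (- Y / m ^+ 2) + dY * (X / m ^+ 2)
      + dY * (m ^+ 2 - X ^+ 2 - Y ^+ 2) / (m ^+ 2 * (m + X))).
    by field; rewrite mX m0'.
  by rewrite hm subrr mulr0 mul0r addr0.
Qed.

Lemma ccontinuous_div f g x : ccontinuous_at f x -> ccontinuous_at g x ->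
  f x != 0 -> ccontinuous_at (fun t => g t / f t) x.
Proof. by move=> fc gc f0; apply: ccontinuousM; [exact: gc|exact: ccontinuousV]. Qed.

(** The constant [c] turns the curve into the slit plane and cancels in the logarithmic
    derivative. *)
Lemma cintegral_dlog f f' a b c : a <= b -> c != 0 ->
  (forall t, a <= t <= b -> is_cderive f t (f' t)) -> ccontinuous_on a b f' ->
  (forall t, a <= t <= b -> slit (c * f t)) ->
  cintegral a b (fun t => f' t / f t) = clog (c * f b) - clog (c * f a).
Proof.
move=> ab c0 ff' fc sf.
have f0 t : a <= t <= b -> f t != 0.
  by move=> /sf/slit_neq0; rewrite mulf_eq0 negb_or => /andP[].
apply: (cintegral_derive (F := fun t => clog (c * f t))) => [//|t tab|t tab].
  apply: is_cderive_eq.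
    by apply: is_cderive_clog; [exact: sf|apply: is_cderiveZ; exact: ff'].
  by rewrite /=; field; rewrite f0// c0.
apply: ccontinuous_div.
- exact: is_cderive_continuous (ff' t tab).
- exact: fc.
- exact: f0.
Qed.

(** On the imaginary axis the half-angle quotient is t / |t|, so the argument is twice [atan] of 1
    or of -1. *)
Lemma clog_imaginary (t : R) : t != 0 ->
  clog (0 +i* t) - clog (0 -i* t) = if 0 < t then (pi *i) else (- (pi *i)).
Proof.
move=> t0.
have it0 : (0 +i* t : R[i]) != 0 by rewrite eq_complex /= eqxx.
have m2 := sqr_modulusE it0; have m0 := modulus_gt0 (0 +i* t).
have mt : modulus (0 +i* t) = `|t|.
  apply/eqP; rewrite -(@eqrXn2 _ 2)// ?ltW// m2 /sqr_modulus /=.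
  by rewrite expr0n add0r real_normK ?num_real.
have mt' : modulus (0 -i* t) = `|t| by rewrite -mt /modulus /sqr_modulus /= sqrrN.
rewrite /clog mt mt' /sqr_modulus /= sqrrN !addr0 mulNr atanN.
have [t1|t1] := ltP 0 t.
  rewrite gtr0_norm// divff// atan1; apply: complexP; rewrite !ReImE /=; first by rewrite subrr.
  by field.
rewrite ler0_norm// invrN mulrN divff// atanN atan1.
apply: complexP; rewrite !ReImE /=; first by rewrite subrr oppr0.
by field.
Qed.

(** * Winding of a closed curve through 0 around a point z *)

Section closed_curve.
Variables (a b : R) (u u' : R -> R[i]) (z : R[i]).
Hypotheses (ab : a <= b) (z0 : z != 0).
Hypothesis du : forall t, a <= t <= b -> is_cderive u t (u' t).
Hypothesis u'c : ccontinuous_on a b u'.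
Hypotheses (ua : u a = 0) (ub : u b = 0).
Hypothesis uz : forall t, a <= t <= b -> u t != z.

(** Since u - z = z w, the pole moves to 0 and the logarithmic derivative is unchanged. The curve
    [w] starts and ends at -1. *)
Let w t := u t / z - 1.
Let w' t := u' t / z.

Let dw t : a <= t <= b -> is_cderive w t (w' t).
Proof.
move=> tab; apply: (is_cderive_ext (f := fun t => z^-1 * u t + -1)).
  by move=> s; rewrite /w mulrC.
apply: is_cderive_eq (is_cderiveD (is_cderiveZ _ (du tab)) (is_cderive_cst _ _)) _.
by rewrite addr0 mulrC.
Qed.

Let w'c : ccontinuous_on a b w'.
Proof. by move=> t tab; apply: ccontinuousM; [exact: u'c|exact: ccontinuous_cst]. Qed.

Let ww' t : u' t / (u t - z) = w' t / w t.
Proof.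
rewrite /w' /w (_ : u t / z - 1 = (u t - z) / z); last by rewrite mulrBl divff.
by rewrite invfM invrK mulrACA mulVf// mulr1.
Qed.

Let w_neq0 t : a <= t <= b -> w t != 0.
Proof.
move=> /uz; apply: contra => /eqP wt; apply/eqP.
by rewrite -[u t](divfK z0) -[u t / z](subrK 1) -/(w t) wt add0r mul1r.
Qed.

Let wa : w a = -1. Proof. by rewrite /w ua mul0r add0r. Qed.
Let wb : w b = -1. Proof. by rewrite /w ub mul0r add0r. Qed.

(** If the curve misses the open ray from 0 through z, then w takes no real value above -1, so -w
    stays in the slit plane. One logarithm then serves the whole closed curve, and its end values
    cancel. *)
Lemma winding_outside :
  (forall t, a <= t <= b -> forall k : R, 0 < k -> u t != k%:C * z) ->
  cintegral a b (fun t => u' t / (u t - z)) = 0.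
Proof.
move=> uk; rewrite (eq_cintegral (g := fun t => w' t / w t)); last by move=> t _; exact: ww'.
rewrite (@cintegral_dlog w _ _ _ (-1))//; first by rewrite wa wb subrr.
move=> t tab; rewrite mulN1r /slit; apply/implyP => /eqP it.
rewrite ltNge; apply/negP => rt.
have k0 : 0 < Re (u t / z).
  by move: rt; rewrite /w !ReImE /=; lra.
have /eqP := uk t tab _ k0; apply.
rewrite -[LHS](divfK z0); congr (_ * _); apply: complexP => //=.
by move: it; rewrite /w !ImN ImD ImN /= oppr0 addr0 => /eqP; rewrite oppr_eq0 => /eqP.
Qed.

(* The curve crosses the line R z once, at t0, in the direction of z or -z. *)
Variable t0 : R.
Hypothesis t0ab : a <= t0 <= b.
Hypothesis ut0 : Im (u t0 / z) = 0.

(** Up to [t0] the curve [w] lies in the closed lower half-plane and afterwards in the upper one, so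
    logarithms turned by i and by -i give the two pieces. The end values at -1 add up to a
    half-turn; those at [w t0] add a half-turn whose sign is that of the real number [w t0]. *)
Lemma winding_star :
  (forall t, a <= t <= t0 -> Im (u t / z) <= 0) ->
  (forall t, t0 <= t <= b -> 0 <= Im (u t / z)) ->
  cintegral a b (fun t => u' t / (u t - z)) = 0 \/
  cintegral a b (fun t => u' t / (u t - z)) = (2 * pi) *i.
Proof.
move=> le0 ge0; have /andP[at0 t0b] := t0ab.
rewrite (eq_cintegral (g := fun t => w' t / w t)); last by move=> t _; exact: ww'.
have Imw t : Im (w t) = Im (u t / z) by rewrite /w ImD ImN /= oppr0 addr0.
have sl t : a <= t <= t0 -> a <= t <= b.
  by move=> /andP[-> /le_trans]; apply.
have sr t : t0 <= t <= b -> a <= t <= b.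
  by move=> /andP[h ->]; rewrite (le_trans at0 h).
rewrite (cintegral_split t0ab); last first.
  move=> t tab; apply: ccontinuous_div; [|exact: w'c|exact: w_neq0].
  exact: is_cderive_continuous (dw tab).
have i0 : 'i%C != 0 :> R[i] by rewrite eq_complex /= oner_eq0 andbF.
rewrite (@cintegral_dlog w w' a t0 'i%C at0 i0); last first.
- by move=> t tab; apply: slit_iM; [exact: w_neq0 (sl _ tab)|rewrite Imw le0].
- by move=> t /sl; exact: w'c.
- by move=> t /sl; exact: dw.
have Ni0 : - 'i%C != 0 :> R[i] by rewrite oppr_eq0.
rewrite (@cintegral_dlog w w' t0 b (- 'i%C) t0b Ni0); last first.
- by move=> t tab; apply: slit_NiM; [exact: w_neq0 (sr _ tab)|rewrite Imw ge0].
- by move=> t /sr; exact: w'c.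
- by move=> t /sr; exact: dw.
have wt0 : w t0 = (Re (w t0))%:C by apply: complexP => //=; rewrite Imw.
have k0 : Re (w t0) != 0.
  by apply: contra (w_neq0 t0ab) => /eqP k0; rewrite wt0 k0.
rewrite wa wb wt0; move: (Re (w t0)) k0 => k k0.
have -> : 'i%C * k%:C = 0 +i* k by apply: complexP; rewrite !ReImE /=; ring.
have -> : - 'i%C * k%:C = 0 -i* k by apply: complexP; rewrite !ReImE /=; ring.
have -> : 'i%C * -1 = 0 -i* 1 :> R[i] by apply: complexP; rewrite !ReImE /=; ring.
have -> : - 'i%C * -1 = 0 +i* 1 :> R[i] by apply: complexP; rewrite !ReImE /=; ring.
have := clog_imaginary (oner_neq0 R); rewrite ltr01.
have := clog_imaginary k0.
move: (clog (0 +i* k)) (clog (0 -i* k)) (clog (0 +i* 1)) (clog (0 -i* 1)).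
move=> A B C D AB CD.
have -> : A - D + (C - B) = (A - B) + (C - D) by ring.
rewrite AB CD; case: ifP => _; [right|left]; apply: complexP; rewrite !ReImE /=; ring.
Qed.

End closed_curve.
End complex_logarithm.

(** * The unit circle and the quotients sin (n x) / sin x *)

Section unit_circle.
Variable R : realType.
Implicit Types (x y : R) (n : nat).

Definition cis x : R[i] := cos x +i* sin x.

Lemma cisD x y : cis (x + y) = cis x * cis y.
Proof. by apply: complexP; rewrite !ReImE /= ?cosD ?sinD; ring. Qed.

Lemma cis0 : cis 0 = 1. Proof. by rewrite /cis cos0 sin0. Qed.

Lemma cisX x n : cis x ^+ n = cis (n%:R * x).
Proof.
elim: n => [|n ih]; first by rewrite expr0 mul0r cis0.
by rewrite exprS ih -cisD -natr1 mulrDl mul1r addrC.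
Qed.

Lemma cis_neq0 x : cis x != 0.
Proof.
apply/eqP => c0; have := cisD x (- x); rewrite subrr c0 mul0r cis0 => /eqP.
by rewrite oner_eq0.
Qed.

Lemma cisV x : (cis x)^-1 = cis (- x).
Proof.
by apply: (mulfI (cis_neq0 x)); rewrite divff ?cis_neq0// -cisD subrr cis0.
Qed.

Lemma is_cderive_cis n x :
  is_cderive (fun t => cis (n%:R * t)) x ((n%:R *i) * cis (n%:R * x)).
Proof.
have dl : is_derive x 1 (n%:R \*: (@idfun R)) n%:R.
  by apply: is_derive_eq; rewrite /GRing.scale/= mulr1.
split.
- rewrite (_ : _ \o _ = (@cos R) \o (n%:R \*: idfun))//.
  by apply: is_derive_eq; rewrite !ReImE /= /GRing.scale/=; ring.
- rewrite (_ : _ \o _ = (@sin R) \o (n%:R \*: idfun))//.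
  by apply: is_derive_eq; rewrite !ReImE /= /GRing.scale/=; ring.
Qed.

(* The quotient sin (n x) / sin x, extended by continuity: its value at 0 is n. *)
Fixpoint usin n x : R :=
  if n is m.+1 then usin m x * cos x + cos (m%:R * x) else 0.

Fixpoint dusin n x : R :=
  if n is m.+1 then
    dusin m x * cos x - usin m x * sin x - m%:R * sin (m%:R * x)
  else 0.

Lemma usinE n x : usin n x * sin x = sin (n%:R * x).
Proof.
elim: n => [|n ih] /=; first by rewrite !mul0r sin0.
by rewrite -natr1 [(_ + 1) * x]mulrDl mul1r sinD -ih; ring.
Qed.

Lemma is_derive_usin n x : is_derive x 1 (usin n) (dusin n x).
Proof.
elim: n => [|n ih]; first exact: is_derive_cst.
have dl : is_derive x 1 (n%:R \*: (@idfun R)) n%:R.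
  by apply: is_derive_eq; rewrite /GRing.scale/= mulr1.
rewrite (_ : usin n.+1 = usin n * (@cos R) + ((@cos R) \o (n%:R \*: idfun)))//.
by apply: is_derive_eq; rewrite /= /GRing.scale/=; ring.
Qed.

(** The differentiated form of [usinE]; it eliminates [dusin] up to a factor sin x. *)
Lemma dusinE n x : dusin n x * sin x = n%:R * cos (n%:R * x) - usin n x * cos x.
Proof.
elim: n => [|n ih] /=; first by rewrite !mul0r subrr.
rewrite -[n.+1%:R]natr1 [(n%:R + 1) * x]mulrDl mul1r cosD -(usinE n x).
transitivity (dusin n x * sin x * cos x - usin n x * sin x ^+ 2
              - n%:R * usin n x * sin x ^+ 2); first by ring.
by rewrite ih; ring.
Qed.

Lemma usinN n x : usin n (- x) = usin n x.
Proof. by elim: n => //= n ->; rewrite mulrN !cosN. Qed.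

Lemma dusinN n x : dusin n (- x) = - dusin n x.
Proof. by elim: n => /= [|n ->]; rewrite ?oppr0// mulrN !sinN cosN usinN; ring. Qed.

Lemma usin0 n : usin n 0 = n%:R.
Proof. by elim: n => //= n ->; rewrite mulr0 cos0 mulr1 natr1. Qed.

Lemma dusin_continuous n x : {for x, continuous (dusin n)}.
Proof.
elim: n => [|n ih]; first exact: cst_continuous.
have uc : {for x, continuous (usin n)} by apply: is_derive_continuous (is_derive_usin n x).
have cc : {for x, continuous (@cos R)} by exact: continuous_cos.
have sc : {for x, continuous (@sin R)} by exact: continuous_sin.
have sn : {for x, continuous (fun t : R => n%:R * sin (n%:R * t))}.
  have := is_cderive_continuous (is_cderive_cis n x).
  case=> _ h; apply: (@continuousM _ _ (fun=> n%:R) _ _ _ h); exact: cst_continuous.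
rewrite (_ : dusin n.+1 = ((dusin n \* @cos R) \- (usin n \* @sin R))
     \- (fun t => n%:R * sin (n%:R * t)))//.
by apply: continuousB => //; apply: continuousB; exact: continuousM.
Qed.

(** By evenness x is nonnegative. At 0 the value is n; for x > 0 both x and n x lie strictly between
    0 and pi, where the sine is positive. *)
Lemma usin_gt0 n x : (0 < n)%N -> n%:R * `|x| < pi -> 0 < usin n x.
Proof.
move=> n0 nx.
have -> : usin n x = usin n `|x|.
  by have [x0|x0] := ger0P x => //; rewrite usinN.
move: (`|x|) (normr_ge0 x) nx => {x} x.
rewrite le_eqVlt => /predU1P[<-|x0] nx; first by rewrite usin0 ltr0n.
have xpi : x < pi.
  by apply: le_lt_trans nx; rewrite ler_peMl ?ler1n// ltW.
have sx : 0 < sin x by rewrite sin_gt0_pi// x0.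
rewrite -(pmulr_lgt0 _ sx) usinE sin_gt0_pi// nx andbT.
by rewrite mulr_gt0// ltr0n.
Qed.

End unit_circle.

(** * The boundary curve *)

Section boundary_curve.
Variables (R : realType) (m : nat).
Hypothesis m_gt0 : (0 < m)%N.
Implicit Types (t : R) (r : nat).
Local Notation p := m.+1.
Local Notation Re := (@complex.Re R).
Local Notation Im := (@complex.Im R).

Definition arc_end : R := pi / p%:R.

Definition rho t := usin p t / usin m t.

(* [curve_polar] gives the polar form rho t * exp (i t). *)
Definition curve t : R[i] := 1 + (usin m t)^-1%:C * cis (p%:R * t).

Definition logder t := dusin m t / usin m t.

Definition dcurve t : R[i] :=
  (usin m t)^-1%:C * cis (p%:R * t) * ((- logder t) +i* p%:R).

Definition xcoord t := usin p t ^+ p / usin m t ^+ m.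

(** The squared modulus of u' / (u - 1) along the curve, by [dcurve_div]. *)
Definition weight t := p%:R ^+ 2 + logder t ^+ 2.

Definition dxcoord t := - (sin t * weight t * rho t ^+ m * usin m t).

Lemma arc_end_gt0 : 0 < arc_end.
Proof. by rewrite divr_gt0 ?pi_gt0. Qed.

Lemma usin_m_gt0 t : - arc_end <= t <= arc_end -> 0 < usin m t.
Proof.
rewrite -ler_norml => tI; apply: usin_gt0 => //.
apply: le_lt_trans (ler_wpM2l _ tI) _; first exact: ler0n.
rewrite mulrCA -[ltRHS]mulr1 ltr_pM2l ?pi_gt0// ltr_pdivrMr// mul1r.
by rewrite ltr_nat.
Qed.

Lemma usin_p_gt0 t : - arc_end < t < arc_end -> 0 < usin p t.
Proof.
rewrite -ltr_norml => tI; apply: usin_gt0 => //.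
by rewrite mulrC -ltr_pdivlMr.
Qed.

Lemma usin_p_end : usin p arc_end = 0.
Proof.
have /eqP : usin p arc_end * sin arc_end = 0.
  by rewrite usinE mulrC divfK ?pnatr_eq0// sinpi.
rewrite mulf_eq0 => /orP[/eqP //|]; rewrite gt_eqF// sin_gt0_pi// arc_end_gt0/=.
rewrite ltr_pdivrMr// -[ltLHS]mulr1 ltr_pM2l ?pi_gt0//.
by rewrite ltr1n ltnS.
Qed.

Lemma usin_p_ge0 t : - arc_end <= t <= arc_end -> 0 <= usin p t.
Proof.
move=> /andP[]; rewrite le_eqVlt => /predU1P[<- _|t1].
  by rewrite usinN usin_p_end.
rewrite le_eqVlt => /predU1P[->|t2]; first by rewrite usin_p_end.
by rewrite ltW// usin_p_gt0// t1.
Qed.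

Lemma rho_ge0 t : - arc_end <= t <= arc_end -> 0 <= rho t.
Proof. by move=> tI; rewrite divr_ge0 ?usin_p_ge0// ltW// usin_m_gt0. Qed.

Lemma rho_gt0 t : - arc_end < t < arc_end -> 0 < rho t.
Proof.
move=> /andP[t1 t2]; rewrite divr_gt0 ?usin_p_gt0 ?usin_m_gt0 ?t1//.
by rewrite !ltW.
Qed.

Lemma cos_p t : cos (p%:R * t) = cos (m%:R * t) * cos t - usin m t * sin t ^+ 2.
Proof. by rewrite -natr1 mulrDl mul1r cosD -(usinE m); ring. Qed.

Lemma sin_p t : sin (p%:R * t) = (usin m t * cos t + cos (m%:R * t)) * sin t.
Proof. by rewrite -usinE. Qed.

Lemma curve_polar t : usin m t != 0 -> curve t = (rho t)%:C * cis t.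
Proof.
move=> S0; apply: complexP; rewrite !ReImE /= ?cos_p ?sin_p /rho /= ?sin2cos2; by field.
Qed.

Lemma curveB1 t : curve t - 1 = (usin m t)^-1%:C * cis (p%:R * t).
Proof. by rewrite /curve addrC addKr. Qed.

Lemma curveB1_neq0 t : usin m t != 0 -> curve t - 1 != 0.
Proof.
move=> S0; rewrite curveB1 mulf_neq0 ?cis_neq0//.
by rewrite (inj_eq (@complexI R)) invr_eq0.
Qed.

Lemma curveX t r : usin m t != 0 ->
  curve t ^+ r = (rho t ^+ r)%:C * cis (r%:R * t).
Proof. by move=> S0; rewrite curve_polar// exprMn cisX -rmorphXn. Qed.

(** By the polar form, u ^ p and u - 1 have the same phase exp (i p t), so their quotient is
    real. *)
Lemma curve_xcoord t : usin m t != 0 ->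
  curve t ^+ p / (curve t - 1) = (xcoord t)%:C.
Proof.
move=> S0; rewrite curveX// curveB1 invfM mulrACA divff ?cis_neq0// mulr1.
rewrite -fmorphV -rmorphM; congr (_%:C).
by rewrite /rho /xcoord invrK expr_div_n exprS [usin m t ^+ p]exprS; field; rewrite S0 expf_neq0.
Qed.

Lemma curve_end : curve arc_end = 0.
Proof.
rewrite curve_polar; first by rewrite /rho usin_p_end mul0r mul0r.
by rewrite gt_eqF// usin_m_gt0// lexx andbT ge0_cp ?ltW// arc_end_gt0.
Qed.

Lemma curve_endN : curve (- arc_end) = 0.
Proof.
rewrite curve_polar; first by rewrite /rho usinN usin_p_end mul0r mul0r.
by rewrite gt_eqF// usin_m_gt0// lexx /= ge0_cp ?ltW// arc_end_gt0.
Qed.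

Lemma is_cderive_real (h : R -> R) t (l : R) :
  is_derive t 1 h l -> is_cderive (fun s => (h s)%:C) t l%:C.
Proof. by split => //; exact: is_derive_cst. Qed.

Lemma is_cderive_curve t : usin m t != 0 -> is_cderive curve t (dcurve t).
Proof.
move=> S0.
have dS := is_deriveV S0 (is_derive_usin m t).
apply: is_cderive_eq (is_cderiveD (is_cderive_cst 1 t)
  (is_cderiveM (is_cderive_real dS) (is_cderive_cis p t))) _.
rewrite add0r /dcurve /logder; apply: complexP; rewrite !ReImE /= /GRing.scale/=; by field.
Qed.

Lemma logder_continuous t : usin m t != 0 -> {for t, continuous logder}.
Proof.
move=> S0; apply: continuousM; first exact: dusin_continuous.
apply: continuousV => //; exact: is_derive_continuous (is_derive_usin m t).
Qed.

Lemma ccontinuous_real (h : R -> R) t : {for t, continuous h} ->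
  ccontinuous_at (fun s => (h s)%:C) t.
Proof. by split => //; exact: cst_continuous. Qed.

Lemma dcurve_continuous t : usin m t != 0 -> ccontinuous_at dcurve t.
Proof.
move=> S0; apply: ccontinuousM.
  apply: ccontinuousM; last exact: is_cderive_continuous (is_cderive_cis p t).
  apply: ccontinuous_real; apply: continuousV => //.
  exact: is_derive_continuous (is_derive_usin m t).
split; last exact: cst_continuous.
by apply: continuousN; exact: logder_continuous.
Qed.

Lemma dcurve_div t : usin m t != 0 ->
  dcurve t / (curve t - 1) = (- logder t) +i* p%:R.
Proof.
move=> S0; rewrite /dcurve -curveB1 mulrAC divff ?mul1r//.
exact: curveB1_neq0.
Qed.

Lemma logder_sin t : usin m t != 0 ->
  m%:R * cos (m%:R * t) / usin m t = logder t * sin t + cos t.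
Proof. by move=> S0; rewrite /logder [_ / _ * sin t]mulrAC dusinE; field. Qed.

(* The left-hand side is u * x'(u) / x(u) at u = curve t, for x(u) = u ^ p / (u - 1). *)
Lemma curve_critical t : usin m t != 0 ->
  dcurve t / (curve t - 1) * (p%:R * (curve t - 1) - curve t)
  = - (sin t * weight t)%:C * cis t.
Proof.
move=> S0; rewrite dcurve_div//.
have -> : p%:R * (curve t - 1) - curve t
    = ((logder t * cos t - p%:R * sin t) * sin t) +i*
      ((logder t * sin t + p%:R * cos t) * sin t).
  have -> : p%:R * (curve t - 1) - curve t = m%:R%:C * (curve t - 1) - 1.
    by rewrite (rmorph_nat (real_complex R)) -natr1; ring.
  have h := logder_sin S0.
  rewrite curveB1; apply: complexP; rewrite !ReImE /= ?cos_p ?sin_p.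
  - transitivity ((m%:R * cos (m%:R * t) / usin m t) * cos t - m%:R * sin t ^+ 2 - 1).
      by field.
    by rewrite h -[X in _ - X = _](cos2Dsin2 t) -natr1; ring.
  - transitivity ((m%:R * cos (m%:R * t) / usin m t) * sin t + m%:R * sin t * cos t).
      by field.
    by rewrite h -natr1; ring.
have -> : sin t * weight t = sin t * weight t * (cos t ^+ 2 + sin t ^+ 2).
  by rewrite cos2Dsin2 mulr1.
have c2 := cos2Dsin2 t.
apply: complexP; rewrite !ReImE /= /weight c2; ring.
Qed.

Lemma curve_kernel t r : usin m t != 0 ->
  curve t ^+ r * (dcurve t / (curve t - 1) * (p%:R * (curve t - 1) - curve t))
  = - (sin t * weight t * rho t ^+ r)%:C * cis (r.+1%:R * t).
Proof.
move=> S0; rewrite curve_critical// curveX//.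
by rewrite -natr1 mulrDl mul1r cisD [(_ * rho _ ^+ _)%:C]rmorphM; ring.
Qed.

Lemma is_derive_xcoord t : usin m t != 0 -> is_derive t 1 xcoord (dxcoord t).
Proof.
move=> S0.
have dS := is_deriveV S0 (is_derive_usin m t).
have dT := is_derive_usin p t.
rewrite (_ : xcoord = (usin p ^+ p * (fun y => (usin m y)^-1) ^+ m)); last first.
  by apply/funext => s; rewrite /xcoord -exprVn !fctE.
apply: is_derive_eq; rewrite /GRing.scale/=.
(* This is what remains of the derivative of the quotient once the powers of [usin p t] and
   [usin m t] are taken out; the first parenthesis is [dusin p t] unfolded. *)
have key : p%:R * (dusin m t * cos t - usin m t * sin t - m%:R * sin (m%:R * t)) * usin m t
   - m%:R * usin p t * dusin m t = - (sin t * weight t * usin m t ^+ 2).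
  have -> : sin t * weight t * usin m t ^+ 2 = sin t * (p%:R ^+ 2 * usin m t ^+ 2 + dusin m t ^+ 2).
    by rewrite /weight /logder; field.
  have h := dusinE m t.
  rewrite -(usinE m t) -[p%:R]natr1 /=.
  (* The two sides differ by a multiple of the relation [dusinE]. *)
  transitivity (- (sin t * ((m%:R + 1) ^+ 2 * usin m t ^+ 2 + dusin m t ^+ 2))
     + dusin m t * (dusin m t * sin t - (m%:R * cos (m%:R * t) - usin m t * cos t))).
    by ring.
  by rewrite h subrr mulr0 addr0.
(* The exponent m - 1 comes from the power rule; it is raised to m, using m > 0, to allow a common
   factor. *)
have -> : (usin m t)^-1 ^+ m.-1 = (usin m t)^-1 ^+ m * usin m t.
  move: (usin m t) S0 => V S0.
  by case: (m) m_gt0 => // k _; rewrite exprSr divfK.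
transitivity (usin p t ^+ m * (usin m t)^-1 ^+ m * (usin m t)^-1 *
  (p%:R * (dusin m t * cos t - usin m t * sin t - m%:R * sin (m%:R * t)) * usin m t
   - m%:R * usin p t * dusin m t)).
  rewrite !exprfctE exprS [usin p t]/=.
  set V := (usin m t)^-1 ^+ m.
  by field.
rewrite key /dxcoord /rho expr_div_n -exprVn.
set V := (usin m t)^-1 ^+ m.
by field.
Qed.

End boundary_curve.

(** * Sums over the roots of a polynomial *)

Lemma sum_horner_deriv_div (F : fieldType) (s : seq F) (x : F) : x \notin s ->
  \sum_(a <- s) (x - a)^-1 =
  (\prod_(a <- s) ('X - a%:P))^`().[x] / (\prod_(a <- s) ('X - a%:P)).[x].
Proof.
elim: s => [_|a s ih]; first by rewrite !big_nil derivC horner0 mul0r.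
rewrite inE negb_or => /andP[xa xs]; rewrite !big_cons ih//.
have q0 : (\prod_(a <- s) ('X - a%:P)).[x] != 0 by rewrite -[_ == 0]/(root _ x) root_prod_XsubC.
rewrite derivM derivXsubC mul1r hornerD !hornerM !hornerXsubC.
by field; rewrite subr_eq0 xa q0.
Qed.

(** A sum of the weights is [w] times the number of entries of weight [w]. In characteristic 0 this
    number must be 1, repetitions included, and that single entry serves every [f]. *)
Lemma single_weight (F : numFieldType) (s : seq F) (n : F -> F) (w : F) :
  w != 0 -> (forall a, a \in s -> n a = 0 \/ n a = w) ->
  \sum_(a <- s) n a = w ->
  exists2 b, b \in s & forall f : F -> F, \sum_(a <- s) f a * n a = f b * w.
Proof.
move=> w0 nw.
have count_n (r : seq F) : {subset r <= s} ->
    \sum_(a <- r) n a = (count (fun a => n a == w) r)%:R * w.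
  elim: r => [_|a r ih rs]; first by rewrite big_nil mul0r.
  rewrite big_cons ih; last by move=> x xr; rewrite rs// inE xr orbT.
  have [na|na] := nw a (rs _ (mem_head _ _)); rewrite /= na.
    by rewrite eq_sym (negbTE w0) !add0r.
  by rewrite eqxx add1n -natr1; ring.
rewrite count_n// -[X in _ = X -> _]mul1r => /(mulIf w0)/eqP; rewrite pnatr_eq1 => /eqP.
move: nw {count_n}; elim: s => // a s ih nw /=.
have nws x : x \in s -> n x = 0 \/ n x = w by move=> xs; apply: nw; rewrite inE xs orbT.
have [na|na] := eqVneq (n a) w.
  rewrite add1n => -[] /eqP; rewrite -leqn0 leqNgt -has_count => /hasPn s0.
  exists a; first exact: mem_head.
  move=> f; rewrite big_cons na big_seq big1 ?addr0// => x xs.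
  by have [->|/eqP] := nws x xs; [rewrite mulr0|rewrite (negbTE (s0 _ xs))].
rewrite add0n => /ih-/(_ nws)[b bs fb]; exists b; first by rewrite inE bs orbT.
move=> f; rewrite big_cons fb.
by have [->|/eqP] := nw a (mem_head _ _); [rewrite mulr0 add0r|rewrite (negbTE na)].
Qed.

(** * The Cauchy transform of the density *)

Section cauchy_integral.
Variables (R : realType) (m : nat).
Hypothesis m_gt0 : (0 < m)%N.
Implicit Types (t : R) (r : nat).
Local Notation p := m.+1.
Local Notation Re := (@complex.Re R).
Local Notation Im := (@complex.Im R).
Local Notation leb := (@lebesgue_measure R).
Local Notation c0 := (arc_end R m).

Let S0 t : - c0 <= t <= c0 -> usin m t != 0.
Proof. by move=> tI; rewrite gt_eqF// usin_m_gt0. Qed.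

Let c0_ge0 : 0 <= c0. Proof. exact/ltW/arc_end_gt0. Qed.

Let cc : - c0 <= c0. Proof. by rewrite ge0_cp. Qed.

Lemma xcoordN t : xcoord m (- t) = xcoord m t.
Proof. by rewrite /xcoord !usinN. Qed.

Lemma rhoN t : rho m (- t) = rho m t. Proof. by rewrite /rho !usinN. Qed.

Lemma logderN t : logder m (- t) = - logder m t.
Proof. by rewrite /logder usinN dusinN mulNr. Qed.

Lemma weightN t : weight m (- t) = weight m t.
Proof. by rewrite /weight logderN sqrrN. Qed.

Lemma xcoord0 : xcoord m 0 = Kedge R p.
Proof. by rewrite /xcoord !usin0. Qed.

Lemma xcoord_end : xcoord m c0 = 0.
Proof. by rewrite /xcoord usin_p_end// expr0n mul0r. Qed.

Lemma weight_gt0 t : 0 < weight m t.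
Proof. by rewrite ltr_wpDr ?sqr_ge0// exprn_gt0. Qed.

Lemma c0_lt_pi : c0 < pi.
Proof.
rewrite /arc_end ltr_pdivrMr// -[ltLHS]mulr1 ltr_pM2l ?pi_gt0//.
by rewrite ltr1n ltnS.
Qed.

Lemma xcoord_continuous t : - c0 <= t <= c0 -> {for t, continuous (xcoord m)}.
Proof. by move=> /S0 h; apply: is_derive_continuous (is_derive_xcoord m_gt0 h). Qed.

Let subI t : 0 <= t <= c0 -> - c0 <= t <= c0.
Proof. by move=> /andP[t0 ->]; rewrite andbT (le_trans _ t0)// oppr_le0. Qed.

Let xcoord_within : {within `[0, c0], continuous (xcoord m)}.
Proof.
apply: continuous_in_subspaceT => t; rewrite inE /= in_itv/= => tI.
exact: xcoord_continuous (subI tI).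
Qed.

(** By evenness it is enough to treat t >= 0, where the derivative is nonpositive; the maximum is
    then the value K_p at 0. *)
Lemma xcoord_range t : - c0 <= t <= c0 -> 0 <= xcoord m t <= Kedge R p.
Proof.
move=> tI; rewrite divr_ge0 ?exprn_ge0 ?usin_p_ge0 ?(ltW (usin_m_gt0 _ _))//=.
wlog t0 : t tI / 0 <= t => [wlog_ge0|].
  have [t0|/ltW t0] := leP 0 t; first exact: wlog_ge0.
  rewrite -xcoordN wlog_ge0 ?oppr_ge0//.
  by move: tI => /andP[t1 t2]; rewrite lerNl opprK t2 lerNl t1.
have tc : t <= c0 by move: tI => /andP[].
rewrite -xcoord0; apply: (@ler0_derive1_le_cc _ _ 0 c0) => //; rewrite ?in_itv/= ?lexx ?t0//.
- move=> s; rewrite in_itv/= => /andP[/ltW s1 /ltW s2].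
  have /S0 sI : - c0 <= s <= c0 by apply: subI; rewrite s1.
  by have [] := is_derive_xcoord m_gt0 sI.
- move=> s; rewrite in_itv/= => /andP[s1 s2].
  have sI : - c0 <= s <= c0 by apply: subI; rewrite !ltW.
  have [_] := is_derive_xcoord m_gt0 (S0 sI).
  rewrite derive1E => ->; rewrite oppr_le0.
  rewrite !mulr_ge0 ?exprn_ge0 ?rho_ge0 ?(ltW (usin_m_gt0 _ _)) ?(ltW (weight_gt0 _))//.
  by rewrite sin_ge0_pi// !ltW// (lt_trans s2) ?c0_lt_pi.
Qed.

Lemma xcoord_surj k : 0 <= k <= Kedge R p -> exists2 t, 0 <= t <= c0 & xcoord m t = k.
Proof.
move=> k01; have [|t] := IVT c0_ge0 xcoord_within (v := k); last by rewrite in_itv; exists t.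
by rewrite xcoord0 xcoord_end min_r ?max_l//; move: k01 => /andP[/le_trans]; apply.
Qed.

(* This is - Im (curve m t ^+ r.+1 * x' / x) / (2 * pi), by [curve_kernel]. *)
Definition density r t : R :=
  sin t * sin (r.+1%:R * t) * rho m t ^+ r * weight m t / (2 * pi).

(** This is u ^ (r + 1) * x' / x along the curve, cleared of the factor u in the denominator. *)
Let ker r t : R[i] :=
  curve m t ^+ r * (dcurve m t / (curve m t - 1) * (p%:R * (curve m t - 1) - curve m t)).

(** The real part of [ker], which is odd in t, whereas the imaginary part is -2 pi times the even
    density. *)
Let oddpart r t : R := - (sin t * weight m t * rho m t ^+ r) * cos (r.+1%:R * t).

Let kerE r t : - c0 <= t <= c0 ->
  ker r t = (oddpart r t)%:C - (2 * pi) *i * (density r t)%:C.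
Proof.
move=> tI; rewrite /ker curve_kernel//; last exact: S0.
have pi0 : pi != 0 :> R by rewrite gt_eqF// pi_gt0.
apply: complexP; rewrite !ReImE /= /density /oddpart; first by ring.
by move: (@pi R) pi0 => PI pi0; field.
Qed.

Let sinpos t : 0 <= t <= c0 -> 0 <= sin t.
Proof.
by move=> /andP[t0 tc]; rewrite sin_ge0_pi// t0 (le_trans tc)// ltW// c0_lt_pi.
Qed.

Lemma densityN r t : density r (- t) = density r t.
Proof. by rewrite /density rhoN weightN mulrN !sinN mulrNN. Qed.

(** The bound r + 1 <= p keeps (r + 1) t <= p t below pi, so both sines are positive. *)
Lemma density_gt0 r t : (r < p)%N -> 0 < t < c0 -> 0 < density r t.
Proof.
move=> rp /andP[t0 tc].
rewrite divr_gt0 ?mulr_gt0 ?exprn_gt0 ?weight_gt0 ?pi_gt0//.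
- by rewrite sin_gt0_pi// t0 (lt_trans tc)// c0_lt_pi.
- rewrite sin_gt0_pi// mulr_gt0//=; apply: (@le_lt_trans _ _ (p%:R * t)).
    by rewrite ler_wpM2r ?ler_nat// ltW.
  by rewrite mulrC -ltr_pdivlMr.
- by apply: rho_gt0 => //; rewrite tc andbT (lt_trans _ t0)// oppr_lt0 arc_end_gt0.
Qed.

Lemma density_ge0 r t : (r < p)%N -> - c0 <= t <= c0 -> 0 <= density r t.
Proof.
move=> rp; wlog t0 : t / 0 <= t => [wlog_ge0 tI|/andP[_ tc]].
  have [t0|/ltW t0] := leP 0 t; first exact: wlog_ge0.
  rewrite -densityN wlog_ge0 ?oppr_ge0//.
  by move: tI => /andP[t1 t2]; rewrite lerNl opprK t2 lerNl t1.
rewrite divr_ge0 ?mulr_ge0 ?exprn_ge0 ?(ltW (weight_gt0 _)) ?(ltW (pi_gt0 _))//.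
- by rewrite sinpos// t0.
- rewrite sin_ge0_pi// mulr_ge0//=; apply: (@le_trans _ _ (p%:R * t)).
    by rewrite ler_wpM2r// ler_nat.
  by rewrite mulrC -ler_pdivlMr.
- by apply: rho_ge0 => //; rewrite tc andbT (le_trans _ t0)// oppr_le0.
Qed.

Let logder_cont t : - c0 <= t <= c0 -> {for t, continuous (logder m)}.
Proof. by move=> /S0; exact: logder_continuous. Qed.

Let rho_cont t : - c0 <= t <= c0 -> {for t, continuous (rho m)}.
Proof.
move=> tI; apply: continuousM; first exact: is_derive_continuous (is_derive_usin p t).
apply: continuousV; first exact: S0.
exact: is_derive_continuous (is_derive_usin m t).
Qed.

Let continuousXn (f : R -> R) (n : nat) t :
  {for t, continuous f} -> {for t, continuous (fun s => f s ^+ n)}.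
Proof.
move=> fc; elim: n => [|n ih]; first exact: cst_continuous.
rewrite (_ : (fun _ => _) = f \* (fun s => f s ^+ n)).
  exact: continuousM.
by apply/funext => s; rewrite exprS.
Qed.

Let weight_cont t : - c0 <= t <= c0 -> {for t, continuous (weight m)}.
Proof.
move=> tI; apply: continuousD; first exact: cst_continuous.
exact: continuousXn (logder_cont tI).
Qed.

Let sinn_cont (n : nat) t : {for t, continuous (fun s : R => sin (n%:R * s))}.
Proof. by have [] := is_cderive_continuous (is_cderive_cis n t). Qed.

Let cosn_cont (n : nat) t : {for t, continuous (fun s : R => cos (n%:R * s))}.
Proof. by have [] := is_cderive_continuous (is_cderive_cis n t). Qed.

Lemma density_continuous r t : - c0 <= t <= c0 -> {for t, continuous (density r)}.
Proof.
move=> tI; apply: continuousM; last exact: cst_continuous.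
apply: continuousM; last exact: weight_cont.
apply: continuousM; last exact: continuousXn (rho_cont tI).
by apply: continuousM; [exact: continuous_sin|exact: sinn_cont].
Qed.

Let oddpart_cont r t : - c0 <= t <= c0 -> {for t, continuous (oddpart r)}.
Proof.
move=> tI; apply: continuousM; last exact: cosn_cont.
apply: continuousN; apply: continuousM; last exact: continuousXn (rho_cont tI).
by apply: continuousM; [exact: continuous_sin|exact: weight_cont].
Qed.

Let oddpartN r t : oddpart r (- t) = - oddpart r t.
Proof. by rewrite /oddpart rhoN weightN sinN mulrN cosN; ring. Qed.

Let curve_cont t : - c0 <= t <= c0 -> ccontinuous_at (curve m) t.
Proof. by move=> /S0/is_cderive_curve/is_cderive_continuous. Qed.

Let dcurve_cont : ccontinuous_on (- c0) c0 (dcurve m).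
Proof. by move=> t /S0; exact: dcurve_continuous. Qed.

Let pow_cont r : ccontinuous_on (- c0) c0 (fun t => curve m t ^+ r * dcurve m t).
Proof. by move=> t tI; apply: ccontinuousM; [apply: ccontinuousX; exact: curve_cont|exact: dcurve_cont]. Qed.

(** Up to the factor r + 1 the integrand is the derivative of u ^ (r + 1), and the curve is
    closed. *)
Lemma cintegral_curveX r : cintegral (- c0) c0 (fun t => curve m t ^+ r * dcurve m t) = 0.
Proof.
have h : cintegral (- c0) c0 (fun t => r.+1%:R * (curve m t ^+ r * dcurve m t)) = 0.
  rewrite (cintegral_derive (F := fun t => curve m t ^+ r.+1) cc).
  - by rewrite curve_end// curve_endN// expr0n subrr.
  - move=> t tI; apply: is_cderive_eq (is_cderiveX r.+1 (is_cderive_curve (S0 tI))) _.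
    by rewrite mulrA.
  - by move=> t tI; apply: ccontinuousM; [exact: ccontinuous_cst|exact: pow_cont].
move: h; rewrite cintegralZ; last exact (pow_cont r).
by move=> /eqP; rewrite mulf_eq0 pnatr_eq0 => /eqP.
Qed.

Section pole.
Variable a : R[i].
Hypothesis curve_a : forall t, - c0 <= t <= c0 -> curve m t != a.

Let sub_neq0 t : - c0 <= t <= c0 -> curve m t - a != 0.
Proof. by move=> /curve_a; rewrite subr_eq0. Qed.

Lemma pole_continuous r :
  ccontinuous_on (- c0) c0 (fun t => curve m t ^+ r * (dcurve m t / (curve m t - a))).
Proof.
move=> t tI; apply: ccontinuousM; first by apply: ccontinuousX; exact: curve_cont.
apply: ccontinuousM; first exact: dcurve_cont.
apply: ccontinuousV; first exact: sub_neq0.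
by apply: ccontinuousD; [exact: curve_cont|exact: ccontinuous_cst].
Qed.

(** Induction on r through u ^ (r + 1) / (u - a) = u ^ r + a u ^ r / (u - a), whose polynomial part
    integrates to 0. *)
Lemma cintegral_pole r :
  cintegral (- c0) c0 (fun t => curve m t ^+ r * (dcurve m t / (curve m t - a))) =
  a ^+ r * cintegral (- c0) c0 (fun t => dcurve m t / (curve m t - a)).
Proof.
elim: r => [|r ih]; first by rewrite expr0 mul1r; apply: eq_cintegral => t _; rewrite expr0 mul1r.
rewrite exprS -mulrA -ih -cintegralZ; last exact (pole_continuous r).
rewrite -[RHS]add0r -(cintegral_curveX r) -cintegralD.
- by apply: eq_cintegral => t tI; rewrite exprS; field; exact: sub_neq0.
- exact (pow_cont r).
- by move=> t tI; apply: ccontinuousM; [exact: ccontinuous_cst|exact: pole_continuous].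
Qed.

End pole.

(** The integrand is -q + i p with q odd, and the interval has length 2 pi / p. *)
Lemma cintegral_pole1 :
  cintegral (- c0) c0 (fun t => dcurve m t / (curve m t - 1)) = (2 * pi) *i.
Proof.
rewrite (eq_cintegral (g := fun t => (- logder m t)%:C + p%:R *i)); last first.
  by move=> t /S0/dcurve_div ->; apply: complexP; rewrite !ReImE /=; ring.
rewrite cintegralD; last 2 first.
  by move=> t tI; apply: ccontinuous_real; apply: continuousN; exact: logder_cont.
  by move=> t tI; exact: ccontinuous_cst.
rewrite (cintegral_odd c0_ge0); last 2 first.
  by move=> t tI; apply: ccontinuous_real; apply: continuousN; exact: logder_cont.
  by move=> t; rewrite logderN; apply: complexP; rewrite !ReImE /= ?oppr0.
rewrite (cintegral_derive (F := fun t => p%:R *i * t%:C) cc).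
- have h : p%:R * c0 = pi by rewrite /arc_end mulrC divfK// pnatr_eq0.
  by apply: complexP; rewrite !ReImE /= -?h; ring.
- move=> t tI; apply: is_cderive_eq (is_cderiveZ _ (is_cderive_real (is_derive_id _ _))) _.
  by rewrite mulr1.
- by move=> t tI; exact: ccontinuous_cst.
Qed.

Lemma curve_neq1 t : - c0 <= t <= c0 -> curve m t != 1.
Proof. by move=> /S0/curveB1_neq0; rewrite subr_eq0. Qed.

Let ker_expand r t : - c0 <= t <= c0 ->
  ker r t = p%:R * (curve m t ^+ r * dcurve m t)
            - curve m t ^+ r.+1 * (dcurve m t / (curve m t - 1)).
Proof.
by move=> /curve_neq1 h; rewrite /ker exprS; field; rewrite subr_eq0.
Qed.

(** Only the pole at 1 contributes, and u ^ (r + 1) equals 1 there. *)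
Let cintegral_ker r : cintegral (- c0) c0 (ker r) = - ((2 * pi) *i).
Proof.
rewrite (eq_cintegral (ker_expand r)) cintegralD; last 2 first.
- by move=> t tI; apply: ccontinuousM; [exact: ccontinuous_cst|exact: (@pow_cont r t tI)].
- by move=> t tI; apply: ccontinuousN; exact: (pole_continuous curve_neq1 r.+1 tI).
rewrite cintegralZ; last exact (pow_cont r).
rewrite cintegralN; last exact (pole_continuous curve_neq1 r.+1).
by rewrite cintegral_curveX mulr0 add0r (cintegral_pole curve_neq1) cintegral_pole1 expr1n mul1r.
Qed.

(* The odd part of the kernel does not contribute, whatever the even factor g. *)
Let cintegral_density_mul r (g : R -> R[i]) : ccontinuous_on (- c0) c0 g ->
  (forall t, g (- t) = g t) ->
  cintegral (- c0) c0 (fun t => ker r t * g t) =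
  - ((2 * pi) *i) * cintegral (- c0) c0 (fun t => (density r t)%:C * g t).
Proof.
move=> gc gN.
have dc : ccontinuous_on (- c0) c0 (fun t => (density r t)%:C * g t).
  move=> t tI; apply: ccontinuousM; last exact: gc.
  by apply: ccontinuous_real; exact: density_continuous.
rewrite -(cintegralZ _ dc).
have oc : ccontinuous_on (- c0) c0 (fun t => (oddpart r t)%:C * g t).
  move=> t tI; apply: ccontinuousM; last exact: gc.
  by apply: ccontinuous_real; exact: oddpart_cont.
rewrite -[RHS]add0r -(@cintegral_odd _ (fun t => (oddpart r t)%:C * g t) c0 c0_ge0 oc); last first.
  by move=> t; rewrite oddpartN gN rmorphN mulNr.
rewrite -(cintegralD oc); last first.
  by move=> t tI; apply: ccontinuousM; [exact: ccontinuous_cst|exact: dc].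
by apply: eq_cintegral => t /kerE ->; ring.
Qed.

(** The integral of the kernel against the even factor 1 is known in two ways; the common factor -2
    pi i cancels. *)
Lemma density_mass r : \int[leb]_(t in `[- c0, c0]) density r t = 1.
Proof.
have := @cintegral_density_mul r (fun=> 1) (fun t _ => ccontinuous_cst _ _) (fun=> erefl).
rewrite (eq_cintegral (g := ker r)); last by move=> t _; rewrite mulr1.
rewrite cintegral_ker -[LHS]mulr1 => /mulfI h.
have {h}/(congr1 (@complex.Re R)) /= -> : 1 = cintegral (- c0) c0 (fun t => (density r t)%:C * 1).
  by apply: h; rewrite oppr_eq0 eq_complex /= negb_and mulf_neq0 ?orbT ?pnatr_eq0// gt_eqF// pi_gt0.
by apply: eq_Rintegral => t _; rewrite mulr1 ?mul0r ?mulr0 ?subr0.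
Qed.

(** * The roots of u ^ p - z u + z for z off the segment *)

Section off_the_segment.
Variable z : R[i].
Hypothesis z_off : ~ segment R p z.

Let trinomial : {poly R[i]} := 'X^p - z *: 'X + z%:P.

Let trinomialE x : trinomial.[x] = x ^+ p - z * x + z.
Proof. by rewrite /trinomial !hornerE. Qed.

Let dtrinomialE x : trinomial^`().[x] = p%:R * x ^+ m - z.
Proof.
rewrite /trinomial derivD derivB derivXn derivZ derivX derivC addr0 /=.
by rewrite !hornerE hornerMn hornerXn mulr_natl.
Qed.

Let z_xcoord t : - c0 <= t <= c0 -> z - (xcoord m t)%:C != 0.
Proof.
move=> /xcoord_range xI; rewrite subr_eq0; apply/eqP => zx; apply: z_off.
by exists (xcoord m t) => //=; rewrite in_itv.
Qed.

Let z_neq0 : z != 0.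
Proof.
have := z_xcoord (t := c0); rewrite xcoord_end subr0; apply.
by rewrite lexx andbT.
Qed.

Let root_neq0 a : root trinomial a -> a != 0.
Proof.
rewrite /root trinomialE; apply: contraL => /eqP ->.
by rewrite expr0n mulr0 subr0 add0r.
Qed.

Let trinomial_curve t : - c0 <= t <= c0 ->
  trinomial.[curve m t] = - (curve m t - 1) * (z - (xcoord m t)%:C).
Proof.
move=> tI; rewrite trinomialE -(curve_xcoord (S0 tI)).
by have := curve_neq1 tI; rewrite -subr_eq0 => h; field.
Qed.

Let trinomial_curve_neq0 t : - c0 <= t <= c0 -> trinomial.[curve m t] != 0.
Proof.
move=> tI; rewrite trinomial_curve// mulf_neq0 ?z_xcoord//.
by rewrite oppr_eq0 subr_eq0 curve_neq1.
Qed.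

Let curve_root a t : root trinomial a -> - c0 <= t <= c0 -> curve m t != a.
Proof.
move=> ra /trinomial_curve_neq0; apply: contra => /eqP ->; exact: ra.
Qed.

Let dcurve_xcoord t : - c0 <= t <= c0 ->
  (dxcoord m t)%:C = ker m t / (curve m t - 1).
Proof.
move=> tI; have St := S0 tI.
rewrite /ker curve_kernel// curveB1 invfM mulrACA divff ?cis_neq0// mulr1.
by rewrite -fmorphV invrK -rmorphN -rmorphM mulNr.
Qed.

(** If the curve never meets the open ray from 0 through a, [winding_outside] applies. If it meets
    the ray at s, the polar form gives Im (u(t) / a) the sign of sin (t - s), as [winding_star]
    requires. *)
Let winding a : root trinomial a ->
  cintegral (- c0) c0 (fun t => dcurve m t / (curve m t - a)) = 0 \/
  cintegral (- c0) c0 (fun t => dcurve m t / (curve m t - a)) = (2 * pi) *i.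
Proof.
move=> ra; have a0 := root_neq0 ra; have ca := curve_root ra.
have dcurveI t : - c0 <= t <= c0 -> is_cderive (curve m) t (dcurve m t).
  by move=> /S0; exact: is_cderive_curve.
have [[s [sI [k k0 sk]]]|none] := pselect (exists s, - c0 <= s <= c0 /\
    exists2 k : R, 0 < k & curve m s = k%:C * a); last first.
  left; apply: winding_outside => //; [exact: curve_endN|exact: curve_end|].
  move=> t tI k k0; apply/eqP => tk; apply: none; exists t; split => //.
  by exists k.
have ra0 : rho m s != 0.
  apply: contra a0 => /eqP r0; move/eqP: sk.
  rewrite curve_polar ?S0// r0 mul0r eq_sym mulf_eq0 => /orP[|//].
  by rewrite eq_complex /= gt_eqF.
have rs : 0 < rho m s by rewrite lt_def ra0 rho_ge0.
have ratio t : - c0 <= t <= c0 -> curve m t / a = (rho m t * k / rho m s)%:C * cis (t - s).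
  move=> tI; have -> : a = (rho m s / k)%:C * cis s.
    rewrite rmorphM fmorphV mulrAC -curve_polar ?S0// sk mulrC mulKf//.
    by rewrite eq_complex /= gt_eqF.
  rewrite curve_polar ?S0// invfM mulrACA cisV -cisD; congr (_ * _).
  by rewrite -fmorphV -rmorphM invf_div mulrA.
have Imratio t : - c0 <= t <= c0 -> Im (curve m t / a) = rho m t * k / rho m s * sin (t - s).
  by move=> /ratio ->; rewrite ImM /= mul0r addr0.
(* As p >= 2 the interval has length at most pi, so sin (t - s) is nonpositive before s and
   nonnegative after it. *)
have c2 : c0 + c0 <= pi.
  rewrite -mulr2n -mulr_natr /arc_end -mulrA ger_pMr ?pi_gt0// mulrC ler_pdivrMr// mul1r.
  by rewrite ler_nat ltnS.
have /andP[s1 s2] := sI.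
apply: winding_star => //; [exact: curve_endN|exact: curve_end|exact: sI| | | ].
- by rewrite Imratio// subrr sin0 mulr0.
- move=> t /andP[t1 t2].
  have tI : - c0 <= t <= c0 by rewrite t1 (le_trans t2).
  rewrite Imratio// mulr_ge0_le0//.
    by rewrite divr_ge0// ?(ltW rs)// mulr_ge0 ?rho_ge0// ltW.
  rewrite -opprB sinN oppr_le0 sin_ge0_pi// subr_ge0 t2/=; lra.
- move=> t /andP[t1 t2].
  have tI : - c0 <= t <= c0 by rewrite t2 (le_trans s1).
  rewrite Imratio// mulr_ge0//.
    by rewrite divr_ge0// ?(ltW rs)// mulr_ge0 ?rho_ge0// ltW.
  rewrite sin_ge0_pi// subr_ge0 t1/=; lra.
Qed.

(** Writing Q for the trinomial, this rests on z - x = - Q / (u - 1) and on p Q - u Q' = - z (p (u -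
    1) - u). *)
Let kernel_dlog r t : - c0 <= t <= c0 ->
  ker r t * (z / (z - (xcoord m t)%:C)) =
  p%:R * (curve m t ^+ r * dcurve m t)
  - curve m t ^+ r.+1 * (dcurve m t * (trinomial^`().[curve m t] / trinomial.[curve m t])).
Proof.
move=> tI; have u1 := curve_neq1 tI; rewrite -subr_eq0 in u1.
have q0 := trinomial_curve_neq0 tI.
have zx : z - (xcoord m t)%:C = trinomial.[curve m t] / - (curve m t - 1).
  by rewrite trinomial_curve// mulrC mulKf// oppr_eq0.
have cX : p%:R * trinomial.[curve m t] - curve m t * trinomial^`().[curve m t]
    = - z * (p%:R * (curve m t - 1) - curve m t).
  by rewrite trinomialE dtrinomialE exprS; ring.
rewrite zx /ker.
transitivity (curve m t ^+ r * dcurve m t / trinomial.[curve m t] *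
    (- z * (p%:R * (curve m t - 1) - curve m t))).
  by field; rewrite u1 q0.
by rewrite -cX exprS; field.
Qed.

(** The logarithmic derivative of the factorization of the trinomial as - (u - 1) (z - x) along the
    curve. *)
Let dcurve_dlog t : - c0 <= t <= c0 ->
  dcurve m t * (trinomial^`().[curve m t] / trinomial.[curve m t]) =
  dcurve m t / (curve m t - 1) - (dxcoord m t)%:C / (z - (xcoord m t)%:C).
Proof.
move=> tI; have u1 := curve_neq1 tI; rewrite -subr_eq0 in u1.
have q0 := trinomial_curve_neq0 tI.
have zx : z - (xcoord m t)%:C = trinomial.[curve m t] / - (curve m t - 1).
  by rewrite trinomial_curve// mulrC mulKf// oppr_eq0.
have cX : trinomial^`().[curve m t] * (curve m t - 1) = trinomial.[curve m t] +
     curve m t ^+ m * (p%:R * (curve m t - 1) - curve m t).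
  by rewrite trinomialE dtrinomialE exprS; ring.
rewrite dcurve_xcoord// zx /ker.
transitivity (dcurve m t / (curve m t - 1) / trinomial.[curve m t] *
    (trinomial^`().[curve m t] * (curve m t - 1))); first by field; rewrite u1 q0.
by rewrite cX; field; rewrite u1 q0.
Qed.

Let resolvent_cont t : - c0 <= t <= c0 ->
  ccontinuous_at (fun s => (z - (xcoord m s)%:C)^-1) t.
Proof.
move=> tI; apply: ccontinuousV; first exact: z_xcoord.
apply: ccontinuousD; first exact: ccontinuous_cst.
by apply: ccontinuousN; apply: ccontinuous_real; exact: xcoord_continuous.
Qed.

Let dxcoord_cont t : - c0 <= t <= c0 -> {for t, continuous (dxcoord m)}.
Proof.
move=> tI; apply: continuousN; apply: continuousM; last first.
  exact: is_derive_continuous (is_derive_usin m t).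
apply: continuousM; last exact: continuousXn (rho_cont tI).
by apply: continuousM; [exact: continuous_sin|exact: weight_cont].
Qed.

(** The root [b] is chosen before [r]: the winding numbers that single it out do not involve [r], so
    one branch serves all the measures. *)
Lemma cauchy_density : exists2 b : R[i], b ^+ p - z * b + z = 0 &
  forall r, cintegral (- c0) c0 (fun t => (density r t)%:C / (z - (xcoord m t)%:C))
            = b ^+ r.+1 / z.
Proof.
have [s def_s] := closed_field_poly_normal trinomial.
have mon : lead_coef trinomial = 1.
  rewrite /trinomial -addrA lead_coefDl ?lead_coefXn// size_polyXn.
  rewrite (leq_ltn_trans (size_polyD _ _))// gtn_max size_polyN.
  rewrite (leq_ltn_trans (size_scale_leq _ _)) ?size_polyX ?ltnS//=.
  by rewrite (leq_trans (size_polyC_leq1 _)).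
rewrite mon scale1r in def_s.
have rs a : a \in s -> root trinomial a by rewrite def_s root_prod_XsubC.
have dlogE t : - c0 <= t <= c0 ->
    trinomial^`().[curve m t] / trinomial.[curve m t] = \sum_(a <- s) (curve m t - a)^-1.
  move=> tI; rewrite def_s -sum_horner_deriv_div//; apply/negP => /rs rt.
  by have := curve_root rt tI; rewrite eqxx.
pose n a := cintegral (- c0) c0 (fun t => dcurve m t / (curve m t - a)).
have pole_cont a r : a \in s ->
    ccontinuous_on (- c0) c0 (fun t => curve m t ^+ r * (dcurve m t / (curve m t - a))).
  by move=> /rs ra; apply: pole_continuous => t; exact: curve_root.
have pole_cont0 a : a \in s ->
    ccontinuous_on (- c0) c0 (fun t => dcurve m t / (curve m t - a)).
  move=> sa t tI; have := pole_cont a 0%N sa t tI.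
  by rewrite (_ : (fun _ => _) = fun s => dcurve m s / (curve m s - a))//;
    apply/funext => x; rewrite expr0 mul1r.
have w0 : (2 * pi) *i != 0 :> R[i].
  by rewrite eq_complex /= negb_and mulf_neq0 ?orbT ?pnatr_eq0// gt_eqF// pi_gt0.
(* By [dcurve_dlog] the total is the winding around 1, minus the integral of x' / (z - x), which is
   odd in t. *)
have sum_n : \sum_(a <- s) n a = (2 * pi) *i.
  rewrite -(cintegral_sum (F := fun a t => dcurve m t / (curve m t - a)))//.
  rewrite (eq_cintegral (g := fun t => dcurve m t / (curve m t - 1) +
      - ((dxcoord m t)%:C / (z - (xcoord m t)%:C)))); last first.
    by move=> t tI; rewrite -dcurve_dlog// dlogE// mulr_sumr.
  have xc : ccontinuous_on (- c0) c0 (fun t => (dxcoord m t)%:C / (z - (xcoord m t)%:C)).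
    move=> t tI; apply: ccontinuousM; last exact: resolvent_cont.
    by apply: ccontinuous_real; exact: dxcoord_cont.
  rewrite cintegralD; last 2 first.
  - move=> t tI; apply: ccontinuousM; first exact: dcurve_cont.
    apply: ccontinuousV; first by rewrite subr_eq0 curve_neq1.
    by apply: ccontinuousD; [exact: curve_cont|exact: ccontinuous_cst].
  - by move=> t tI; apply: ccontinuousN; exact: xc.
  rewrite cintegral_pole1 cintegralN// cintegral_odd ?subr0//.
  by move=> t; rewrite xcoordN /dxcoord weightN rhoN usinN sinN !mulNr rmorphN mulNr.
have [b bs nb] := single_weight w0 (fun a sa => winding (rs a sa)) sum_n.
exists b; first by rewrite -trinomialE; apply/eqP/rs.
move=> r; pose g t := z / (z - (xcoord m t)%:C).
have gc : ccontinuous_on (- c0) c0 g.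
  by move=> t tI; apply: ccontinuousM; [exact: ccontinuous_cst|exact: resolvent_cont].
have := @cintegral_density_mul r g gc (fun t => ltac:(by rewrite /g xcoordN)).
(* The kernel times z / (z - x) splits into a polynomial part, with integral 0, and simple poles at
   the roots. *)
rewrite (eq_cintegral (g := fun t => p%:R * (curve m t ^+ r * dcurve m t) +
   - (\sum_(a <- s) curve m t ^+ r.+1 * (dcurve m t / (curve m t - a))))); last first.
  by move=> t tI; rewrite kernel_dlog// dlogE// mulr_sumr mulr_sumr.
rewrite cintegralD; last 2 first.
- by move=> t tI; apply: ccontinuousM; [exact: ccontinuous_cst|exact: (@pow_cont r t tI)].
- move=> t tI; apply: ccontinuousN.
  exact: ccontinuous_on_sum (fun a sa => pole_cont a r.+1 sa) _ tI.
rewrite cintegralZ; last exact (pow_cont r).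
rewrite cintegral_curveX mulr0 add0r cintegralN; last first.
  exact: ccontinuous_on_sum (fun a sa => pole_cont a r.+1 sa).
rewrite (cintegral_sum (F := fun a t => curve m t ^+ r.+1 * (dcurve m t / (curve m t - a)))); last first.
  by move=> a sa; exact: pole_cont.
have -> : \sum_(a <- s) cintegral (- c0) c0 (fun t => curve m t ^+ r.+1 * (dcurve m t / (curve m t - a)))
    = b ^+ r.+1 * ((2 * pi) *i).
  rewrite -(nb (fun a => a ^+ r.+1)); apply: eq_big_seq => a /rs ra.
  by rewrite cintegral_pole// => t; exact: curve_root.
rewrite mulNr => /oppr_inj; rewrite mulrC => /(mulfI w0) ->.
rewrite [RHS]mulrC -cintegralZ.
  by apply: eq_cintegral => t tI; rewrite /g; field; rewrite z_neq0 z_xcoord.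
move=> t tI; apply: ccontinuousM; last exact: gc.
by apply: ccontinuous_real; exact: density_continuous.
Qed.

End off_the_segment.

End cauchy_integral.

(** * Topology and measurability on the complex plane *)

Section complex_plane.
Variable R : realType.
Local Notation Re := (@complex.Re R).
Local Notation Im := (@complex.Im R).

Lemma normc_ge_Im (z : R[i]) : `|Im z|%:C <= `|z|.
Proof.
have := normc_ge_Re (z * 'i%C).
by rewrite ReiNIm normrN normrM [`|'i%C|]normc_def /= expr0n expr1n add0r sqrtr1 mulr1.
Qed.

Lemma normc_le_ReIm (z : R[i]) : `|z| <= (`|Re z| + `|Im z|)%:C.
Proof.
rewrite {1}[z]complexE (le_trans (ler_normD _ _))// normrM.
rewrite ![`|_%:C|]normc_def [`|'i%C|]normc_def /= !expr0n /= !addr0 expr1n add0r sqrtr1 mul1r.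
by rewrite !sqrtr_sqr rmorphD.
Qed.

Lemma continuous_Re : continuous (Re : R[i] -> R).
Proof.
move=> z; apply/(@cvgrPdist_lt _ _ _ (nbhs z) (nbhs_filter z)) => e e0.
near=> w.
have : ball z e%:C w by near: w; apply: nbhsx_ballx; rewrite ltcR.
rewrite -ball_normE /= => zw.
by rewrite -ReN -ReD -ltcR (le_lt_trans (normc_ge_Re _)).
Unshelve. all: by end_near. Qed.

Lemma continuous_Im : continuous (Im : R[i] -> R).
Proof.
move=> z; apply/(@cvgrPdist_lt _ _ _ (nbhs z) (nbhs_filter z)) => e e0.
near=> w.
have : ball z e%:C w by near: w; apply: nbhsx_ballx; rewrite ltcR.
rewrite -ball_normE /= => zw.
by rewrite -ImN -ImD -ltcR (le_lt_trans (normc_ge_Im _)).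
Unshelve. all: by end_near. Qed.

(** The order of R[i] makes positive numbers real, so radii of balls may be taken in R. *)
Lemma complex_gt0P (e : R[i]) : 0 < e -> exists2 d : R, 0 < d & e = d%:C.
Proof. by case: e => a b; rewrite ltcE /= => /andP[/eqP -> a0]; exists a. Qed.

Lemma continuous_real_complex : continuous (fun x : R => x%:C : R[i]).
Proof.
move=> x; apply/(@cvgrPdist_lt _ _ _ (nbhs x) (nbhs_filter x)) => e /complex_gt0P[d d0 ->].
near=> y.
have : ball x d y by near: y; exact: nbhsx_ballx.
rewrite -ball_normE /= => xy.
by rewrite -rmorphB normc_def /= expr0n addr0 sqrtr_sqr ltcR.
Unshelve. all: by end_near. Qed.

Lemma open_measurable_complex (U : set R[i]) : open U -> measurable (U : set (borelC R)).
Proof. by move=> oU; exact: sub_sigma_algebra. Qed.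

Lemma measurable_continuous_complex (f : R[i] -> R) :
  continuous f -> measurable_fun [set: borelC R] f.
Proof.
move=> /continuousP cf; apply: (measurability _ (RGenOpens.measurableE R)).
move=> _ [_ [a [b ->] <-]]; rewrite setTI; apply: open_measurable_complex.
exact/cf/interval_open.
Qed.

(** The point 0 is split off; on its open complement inversion is continuous. *)
Lemma measurable_realV : measurable_fun [set: R] (fun x : R => x^-1).
Proof.
rewrite -(setUv [set 0 : R]); apply/measurable_funU => //.
  exact: measurableC.
split; first exact: measurable_fun_set1.
apply: open_continuous_measurable_fun.
  by apply: closed_openC; exact: closed_eq.
by move=> x; rewrite inE => /= /eqP x0; exact: inv_continuous.
Qed.

Lemma measurable_Re_sub (z : R[i]) :
  measurable_fun [set: borelC R] (fun w : borelC R => Re (z - (w : R[i]))).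
Proof.
rewrite (_ : (fun _ => _) = (fun w : borelC R => Re z - Re w)).
  by apply: measurable_funB => //; apply: measurable_continuous_complex; exact: continuous_Re.
by apply/funext => w; rewrite ReD ReN.
Qed.

Lemma measurable_Im_sub (z : R[i]) :
  measurable_fun [set: borelC R] (fun w : borelC R => Im (z - (w : R[i]))).
Proof.
rewrite (_ : (fun _ => _) = (fun w : borelC R => Im z - Im w)).
  by apply: measurable_funB => //; apply: measurable_continuous_complex; exact: continuous_Im.
by apply/funext => w; rewrite ImD ImN.
Qed.

Lemma measurable_ReV_sub (z : R[i]) :
  measurable_fun [set: borelC R] (fun w : borelC R => Re (z - (w : R[i]))^-1).
Proof.
have mRe := measurable_Re_sub z; have mIm := measurable_Im_sub z.
rewrite (_ : (fun _ => _) = (fun w : borelC R => Re (z - (w : R[i])) *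
   (Re (z - (w : R[i])) ^+ 2 + Im (z - (w : R[i])) ^+ 2)^-1)); last first.
  by apply/funext => w; rewrite ReV.
apply: measurable_funM => //; apply: (measurableT_comp measurable_realV).
by apply: measurable_funD; exact: measurable_funX.
Qed.

Lemma measurable_ImV_sub (z : R[i]) :
  measurable_fun [set: borelC R] (fun w : borelC R => Im (z - (w : R[i]))^-1).
Proof.
have mRe := measurable_Re_sub z; have mIm := measurable_Im_sub z.
rewrite (_ : (fun _ => _) = (fun w : borelC R => - Im (z - (w : R[i])) *
   (Re (z - (w : R[i])) ^+ 2 + Im (z - (w : R[i])) ^+ 2)^-1)); last first.
  by apply/funext => w; rewrite ImV.
apply: measurable_funM; first exact: measurableT_comp.
apply: (measurableT_comp measurable_realV).
by apply: measurable_funD; exact: measurable_funX.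
Qed.

Lemma segmentP p (z : R[i]) :
  segment R p z <-> Im z = 0 /\ 0 <= Re z <= Kedge R p.
Proof.
split=> [[x /= xI <-]|[]]; first by move: xI; rewrite in_itv.
by case: z => x y /= -> xK; exists x => //=; rewrite in_itv.
Qed.

Lemma complex_segment_compact p : compact (segment R p).
Proof.
apply: continuous_compact; last exact: segment_compact.
exact/continuous_subspaceT/continuous_real_complex.
Qed.

Lemma complex_segment_closed p : closed (segment R p).
Proof. by apply: compact_closed; [exact: norm_hausdorff|exact: complex_segment_compact]. Qed.

Lemma dist_segment p (z : R[i]) : ~ segment R p z ->
  exists2 d : R, 0 < d & forall w, segment R p w -> d%:C <= `|z - w|.
Proof.
move=> zs; have : nbhs z (~` segment R p).
  by apply: open_nbhs_nbhs; split => //; apply: closed_openC; exact: complex_segment_closed.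
move=> /nbhs_ballP[e /= /complex_gt0P[d d0 ->] dz]; exists d => // w sw.
rewrite real_leNgt; last 2 first.
- by apply/complex_realP; exists d.
- exact: normr_real.
by apply/negP => zw; apply: (dz w) => //; rewrite -ball_normE.
Qed.

End complex_plane.

(** * The measures *)

Section density_probability.
Variable R : realType.
Local Notation leb := (@lebesgue_measure R).

(** The properties are bundled with the function so that [density_prob] is recognized as a
    probability for each [pdf]. *)
Record pdf := Pdf {
  pdf_fun :> R -> R;
  pdf_ge0 : forall t, 0 <= pdf_fun t;
  pdf_measurable : measurable_fun [set: R] pdf_fun;
  pdf_mass : (\int[leb]_t (pdf_fun t)%:E = 1)%E }.

Definition density_prob (f : pdf) (A : set (measurableTypeR R)) : \bar R :=
  (\int[leb]_(t in A) (f t)%:E)%E.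

Variable f : pdf.
Local Notation fprob := (density_prob f).

Let density0 : fprob set0 = 0%E.
Proof. by rewrite /density_prob integral_set0. Qed.

Let density_ge0 A : (0 <= fprob A)%E.
Proof. by apply: integral_ge0 => t _; rewrite lee_fin pdf_ge0. Qed.

Let integrable_pdf : leb.-integrable [set: R] (EFin \o f).
Proof.
apply/integrableP; split; first by apply/measurable_EFinP; apply: pdf_measurable.
under eq_integral do rewrite /= ger0_norm ?pdf_ge0//.
by rewrite /= pdf_mass ltry.
Qed.

Let density_sigma_additive : semi_sigma_additive fprob.
Proof.
move=> /= A mA tA mUA.
rewrite /density_prob/= integral_bigcup//=; last first.
  by apply: integrableS integrable_pdf.
apply: is_cvg_ereal_nneg_natsum_cond => n _ _.
by apply: integral_ge0 => /= x ?; rewrite lee_fin pdf_ge0.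
Qed.

HB.instance Definition _ := isMeasure.Build _ _ _
  fprob density0 density_ge0 density_sigma_additive.

Let density_setT : fprob [set: _] = 1%E.
Proof. exact: (pdf_mass f). Qed.

HB.instance Definition _ :=
  @Measure_isProbability.Build _ _ R fprob density_setT.

Let density_dom : fprob `<< leb.
Proof.
apply/null_content_dominatesP => A mA A0; rewrite /density_prob.
apply: null_set_integral => //; apply: measurable_funTS.
exact: measurable_int integrable_pdf.
Qed.

(** The Radon-Nikodym derivative of [fprob] has the same integral as [f] over every measurable set,
    hence equals it almost everywhere and may be replaced by it. *)
Lemma integral_density_prob (g : R -> \bar R) :
  fprob.-integrable [set: R] g ->
  (\int[fprob]_t g t = \int[leb]_t (g t * (f t)%:E))%E.
Proof.
move=> ig; have mg := measurable_int _ ig.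
rewrite -(Radon_Nikodym_change_of_variables density_dom)//=.
apply: ae_eq_integral => //.
- exact: emeasurable_funM.
- by apply: emeasurable_funM => //; apply/measurable_EFinP; apply: pdf_measurable.
- refine (@ae_eqe_mul2l _ _ _ leb setT _ (EFin \o f) g _); apply: integral_ae_eq => //=.
  + by apply: Radon_Nikodym_integrable; exact: density_dom.
  + by apply/measurable_EFinP; apply: pdf_measurable.
  + by move=> E _ mE; rewrite -Radon_Nikodym_integral//; exact: density_dom.
Qed.

End density_probability.

(** * The image of the density on the segment *)

Section raney_measure.
Variables (R : realType) (m r : nat).
Hypotheses (m_gt0 : (0 < m)%N) (r_lt : (r < m.+1)%N).
Local Notation Re := (@complex.Re R).
Local Notation Im := (@complex.Im R).
Local Notation leb := (@lebesgue_measure R).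
Local Notation c0 := (arc_end R m).
Local Notation I := (`[- c0, c0]%classic : set R).

Let inI t : I t -> - c0 <= t <= c0. Proof. by rewrite /= in_itv. Qed.

Let measurable_onI (h : R -> R) :
  (forall t, - c0 <= t <= c0 -> {for t, continuous h}) -> measurable_fun [set: R] (h \_ I).
Proof.
move=> hc; apply/(measurable_restrictT h (measurable_itv _)).
apply: subspace_continuous_measurable_fun; first exact: measurable_itv.
by apply: continuous_in_subspaceT => t; rewrite inE => /inI/hc.
Qed.

Let density_mass_setT : (\int[leb]_t ((density m r \_ I) t)%:E = 1)%E.
Proof.
have id : leb.-integrable I (EFin \o density m r).
  by apply: continuous_on_segment_integrable => t; exact: density_continuous.
have <- : (\int[leb]_(t in I) density m r t)%:E = 1%E by rewrite density_mass.
rewrite /Rintegral fineK; last exact: integrable_fin_num.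
by rewrite [RHS]integral_mkcond restrict_EFin.
Qed.

Let density_patch_ge0 t : 0 <= (density m r \_ I) t.
Proof. by rewrite patchE; case: ifPn => // /set_mem/inI; exact: density_ge0. Qed.

Definition raney_pdf : pdf R := Pdf density_patch_ge0
  (measurable_onI (@density_continuous _ _ m_gt0 r)) density_mass_setT.

(** Off the parameter interval the default value is 0, which still belongs to the segment, so all
    values lie there. *)
Definition raney_point (t : measurableTypeR R) : borelC R := ((xcoord m \_ I) t)%:C.

Lemma measurable_raney_point : measurable_fun [set: measurableTypeR R] raney_point.
Proof.
refine (@measurability _ _ _ _ setT raney_point (@open R[i]) erefl _) => _ [U oU <-]; rewrite setTI.
have mU : measurable ((fun x : R => x%:C) @^-1` U).
  by apply: open_measurable; move/continuousP: (@continuous_real_complex R); exact.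
have := measurable_onI (@xcoord_continuous _ _ m_gt0) measurableT mU.
by rewrite setTI.
Qed.

HB.instance Definition _ :=
  isMeasurableFun.Build _ _ _ _ raney_point measurable_raney_point.

(** The index is shifted by one: this is mu_{p,r+1}. *)
Definition raney_measure : probability (borelC R) R :=
  @distribution _ _ (measurableTypeR R) (borelC R) R (density_prob raney_pdf) raney_point.

Lemma raney_measureE (U : set (borelC R)) : 
  raney_measure U = (\int[leb]_(t in raney_point @^-1` U) ((density m r \_ I) t)%:E)%E.
Proof. by []. Qed.

Lemma raney_point_segment t : segment R m.+1 (raney_point t).
Proof.
apply/segmentP; split=> //; rewrite /raney_point /= patchE.
case: ifPn => [/set_mem/inI/xcoord_range -> //|_]; rewrite lexx /=.
by rewrite divr_ge0// exprn_ge0.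
Qed.

Lemma raney_measure_segment : raney_measure (segment R m.+1) = 1%E.
Proof.
rewrite raney_measureE (_ : _ @^-1` _ = setT); first exact: density_mass_setT.
by apply/seteqP; split=> // t _; exact: raney_point_segment.
Qed.

(** Two changes of variables, for the image measure and for the density. A bound for [g] on the
    segment gives integrability, as [raney_point] takes its values there. *)
Lemma Rintegral_raney_measure (g : borelC R -> R) (M : R) :
  measurable_fun [set: borelC R] g ->
  (forall w, segment R m.+1 w -> `|g w| <= M) ->
  \int[raney_measure]_w g w =
  \int[leb]_(t in I) (density m r t * g (xcoord m t)%:C).
Proof.
move=> mg gM.
have mgX : measurable_fun [set: R] (g \o raney_point).
  exact: (measurableT_comp mg measurable_raney_point).
have ig : (density_prob raney_pdf).-integrable [set: R] (EFin \o (g \o raney_point)).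
  apply: measurable_bounded_integrable => //.
    by apply: (@le_lt_trans _ _ 1%E); [exact: probability_le1|exact: ltry].
  exists M; split; first exact: num_real.
  by move=> x Mx t _; rewrite /= (le_trans _ (ltW Mx))// gM//; exact: raney_point_segment.
rewrite {1}/Rintegral integral_distribution//=; last exact/measurable_EFinP.
rewrite integral_density_prob//= [RHS]Rintegral_mkcond.
congr fine; apply: eq_integral => t _; rewrite -EFinM; congr (_%:E).
rewrite !patchE /raney_point patchE mulrC.
by case: ifPn => // _; rewrite mul0r.
Qed.

Lemma cauchy_transform_raney z : ~ segment R m.+1 z ->
  cauchy_transform raney_measure z =
  cintegral (- c0) c0 (fun t => (density m r t)%:C / (z - (xcoord m t)%:C)).
Proof.
move=> /dist_segment[d d0 dz].
have Vb w : segment R m.+1 w -> `|(z - w)^-1| <= (d^-1)%:C.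
  move=> /dz dzw; have d1 : 0 < d%:C by rewrite ltcR.
  by rewrite normfV fmorphV lef_pV2// posrE// (lt_le_trans d1).
apply: complexP => /=.
- rewrite (@Rintegral_raney_measure _ d^-1); last 2 first.
  + exact: measurable_ReV_sub.
  + by move=> w /Vb; rewrite -lecR; apply: le_trans; exact: normc_ge_Re.
  by apply: eq_Rintegral => t _; rewrite ReM /= mul0r subr0.
- rewrite (@Rintegral_raney_measure _ d^-1); last 2 first.
  + exact: measurable_ImV_sub.
  + by move=> w /Vb; rewrite -lecR; apply: le_trans; exact: normc_ge_Im.
  by apply: eq_Rintegral => t _; rewrite ImM /= mul0r addr0.
Qed.

End raney_measure.

(** * Behaviour at infinity and differentiability of the Cauchy transform *)

Section cauchy_transform_regularity.
Variables (R : realType) (m r : nat).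
Hypotheses (m_gt0 : (0 < m)%N) (r_lt : (r < m.+1)%N).
Local Notation p := m.+1.
Local Notation Re := (@complex.Re R).
Local Notation Im := (@complex.Im R).
Local Notation leb := (@lebesgue_measure R).
Local Notation c0 := (arc_end R m).
Local Notation K := (Kedge R p).

Definition density_mean (g : R -> R[i]) : R[i] :=
  cintegral (- c0) c0 (fun t => (density m r t)%:C * g t).

Let dens_cont t : - c0 <= t <= c0 -> ccontinuous_at (fun s => (density m r s)%:C) t.
Proof. by move=> tI; apply: ccontinuous_real; exact: density_continuous. Qed.

Lemma Rintegral_density_bound (h : R -> R) (B : R) :
  (forall t, - c0 <= t <= c0 -> {for t, continuous h}) ->
  (forall t, - c0 <= t <= c0 -> `|h t| <= B) ->
  `|\int[leb]_(t in `[- c0, c0]) (density m r t * h t)| <= B.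
Proof.
move=> hc hB.
have ih : leb.-integrable `[- c0, c0] (EFin \o (fun t => density m r t * h t)).
  apply: continuous_on_segment_integrable => t tI; apply: continuousM; last exact: hc.
  exact: density_continuous.
apply: (le_trans (le_normr_Rintegral _ ih)) => //.
have idn : leb.-integrable `[- c0, c0] (EFin \o density m r).
  by apply: continuous_on_segment_integrable => t tI; exact: density_continuous.
have -> : B = \int[leb]_(t in `[- c0, c0]) (density m r t * B).
  by rewrite RintegralZr// density_mass// mul1r.
apply: le_Rintegral => //.
- apply: continuous_on_segment_integrable => t tI.
  apply: (continuous_comp (f := fun s => density m r s * h s)); last exact: norm_continuous.
  apply: continuousM; last exact: hc.
  exact: density_continuous.
- apply: continuous_on_segment_integrable => t tI; apply: continuousM; last exact: cst_continuous.
  exact: density_continuous.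
- move=> t; rewrite /= in_itv/= => tI.
  by rewrite normrM ger0_norm ?density_ge0// ler_wpM2l ?hB// density_ge0.
Qed.

(** The factor 2 comes from estimating the real and imaginary parts separately. *)
Lemma density_mean_bound g (B : R) : ccontinuous_on (- c0) c0 g ->
  (forall t, - c0 <= t <= c0 -> `|g t| <= B%:C) -> `|density_mean g| <= (2 * B)%:C.
Proof.
move=> gc gB; apply: (le_trans (normc_le_ReIm _)); rewrite lecR mulr2n mulrDl mul1r /=.
apply: lerD.
- rewrite (@eq_Rintegral _ _ _ leb _ (fun t => density m r t * Re (g t))); last first.
    by move=> t _; rewrite ReM /= mul0r subr0.
  apply: Rintegral_density_bound => t tI; first by have [] := gc t tI.
  by rewrite -lecR (le_trans (normc_ge_Re _))// gB.
- rewrite (@eq_Rintegral _ _ _ leb _ (fun t => density m r t * Im (g t))); last first.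
    by move=> t _; rewrite ImM /= mul0r addr0.
  apply: Rintegral_density_bound => t tI; first by have [] := gc t tI.
  by rewrite -lecR (le_trans (normc_ge_Im _))// gB.
Qed.

Lemma density_mean1 : density_mean (fun=> 1) = 1.
Proof.
apply: complexP => /=.
  rewrite -[RHS](@density_mass R m m_gt0 r); apply: eq_Rintegral => t _.
  by rewrite mulr1 mulr0 subr0.
by under eq_Rintegral do rewrite mulr0 mul0r addr0; rewrite Rintegral_cst// mul0r.
Qed.

Lemma density_meanZ c g : ccontinuous_on (- c0) c0 g ->
  density_mean (fun t => c * g t) = c * density_mean g.
Proof.
move=> gc; rewrite -cintegralZ; last first.
  by move=> t tI; apply: ccontinuousM; [exact: dens_cont|exact: gc].
by apply: eq_cintegral => t _; ring.
Qed.

Lemma density_meanD g h : ccontinuous_on (- c0) c0 g -> ccontinuous_on (- c0) c0 h ->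
  density_mean (fun t => g t + h t) = density_mean g + density_mean h.
Proof.
move=> gc hc; rewrite -cintegralD.
- by apply: eq_cintegral => t _; rewrite mulrDr.
- by move=> t tI; apply: ccontinuousM; [exact: dens_cont|exact: gc].
- by move=> t tI; apply: ccontinuousM; [exact: dens_cont|exact: hc].
Qed.

Local Notation G := (cauchy_transform (raney_measure R m_gt0 r_lt)).

Lemma cauchy_transform_mean z : ~ segment R p z ->
  G z = density_mean (fun t => (z - (xcoord m t)%:C)^-1).
Proof. exact: cauchy_transform_raney. Qed.

Let xsegment t : - c0 <= t <= c0 -> segment R p (xcoord m t)%:C.
Proof. by move=> tI; apply/segmentP; split=> //; exact: xcoord_range. Qed.

Let sub_neq0 z t : ~ segment R p z -> - c0 <= t <= c0 -> z - (xcoord m t)%:C != 0.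
Proof.
move=> zs tI; rewrite subr_eq0; apply/eqP => zE; apply: zs; rewrite zE.
exact: xsegment.
Qed.

Let sub_cont z t : - c0 <= t <= c0 -> ccontinuous_at (fun s => z - (xcoord m s)%:C) t.
Proof.
move=> tI; apply: ccontinuousD; first exact: ccontinuous_cst.
by apply: ccontinuousN; apply: ccontinuous_real; exact: xcoord_continuous.
Qed.

Let subV_cont z : ~ segment R p z ->
  ccontinuous_on (- c0) c0 (fun s => (z - (xcoord m s)%:C)^-1).
Proof. by move=> zs t tI; apply: ccontinuousV; [exact: sub_neq0|exact: sub_cont]. Qed.

Lemma large_not_segment z : K%:C < `|z| -> ~ segment R p z.
Proof.
move=> zK /segmentP[iz /andP[r0 rK]]; move: zK.
rewrite normc_def iz expr0n addr0 sqrtr_sqr ger0_norm// ltcR ltNge rK.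
by [].
Qed.

Lemma leading_term_cauchy : leading_term G 1.
Proof.
(* For |z| > 2 K and 0 <= x <= K one has |z - x| >= |z| / 2, so 1 / (z - x) - 1 / z = x / (z (z -
   x)) is at most 2 K / |z| ^ 2; [density_mean_bound] doubles this. *)
exists (4 * K), (2 * K) => z zK.
have K0 : 0 <= K by rewrite divr_ge0// exprn_ge0.
have z0 : 0 < `|z| by apply: le_lt_trans zK; rewrite ler0c mulr_ge0.
have zs : ~ segment R p z.
  by apply: large_not_segment; apply: le_lt_trans zK; rewrite lecR ler_peMl// ler1n.
have zn0 : z != 0 by rewrite -normr_gt0.
rewrite cauchy_transform_mean//.
pose g t := (xcoord m t)%:C / (z * (z - (xcoord m t)%:C)).
have gc : ccontinuous_on (- c0) c0 g.
  move=> t tI; apply: ccontinuousM.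
    by apply: ccontinuous_real; exact: xcoord_continuous.
  apply: ccontinuousV; first by rewrite mulf_neq0// sub_neq0.
  by apply: ccontinuousM; [exact: ccontinuous_cst|exact: sub_cont].
have -> : density_mean (fun t => (z - (xcoord m t)%:C)^-1) - 1%:C / z = density_mean g.
  rewrite rmorph1 mul1r -[X in _ - X](mulr1) -density_mean1 -mulNr.
  rewrite -density_meanZ; last by move=> t _; exact: ccontinuous_cst.
  rewrite -density_meanD; last 2 first.
  - exact: subV_cont.
  - by move=> t _; exact: ccontinuous_cst.
  apply: eq_cintegral => t tI; congr (_ * _); rewrite /g.
  by field; rewrite zn0 sub_neq0.
have nz : `|z| = (Re `|z|)%:C by rewrite normc_def.
have rz0 : 0 < Re `|z| by rewrite -ltcR -nz.
have -> : (4 * K)%:C / `|z| ^+ 2 = (2 * (2 * K / (Re `|z|) ^+ 2))%:C.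
  rewrite [in LHS]nz -rmorphXn -fmorphV -rmorphM; congr (_%:C).
  by field; rewrite gt_eqF.
apply: density_mean_bound => // t tI; rewrite /g normrM normfV normrM.
have /andP[x0 xK] := xcoord_range m_gt0 tI.
have nx : `|(xcoord m t)%:C : R[i]| = (xcoord m t)%:C.
  by rewrite normc_def /= expr0n addr0 sqrtr_sqr ger0_norm.
have zx : (Re `|z| / 2)%:C <= `|z - (xcoord m t)%:C|.
  apply: le_trans (lerB_dist _ _); rewrite nx nz -rmorphB lecR.
  move: zK; rewrite nz ltcR; lra.
rewrite nx nz.
apply: (@le_trans _ _ (K%:C / ((Re `|z|)%:C * (Re `|z| / 2)%:C))).
  have rz1 : 0 < (Re `|z|)%:C by rewrite ltcR.
  have rz2 : 0 < (Re `|z| / 2)%:C by rewrite ltcR divr_gt0.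
  apply: ler_pM.
  - by rewrite ler0c.
  - by rewrite invr_ge0 mulr_ge0 ?normr_ge0// ltW.
  - by rewrite lecR.
  - rewrite lef_pV2 ?posrE ?mulr_gt0//; last exact: lt_le_trans zx.
    by rewrite ler_pM2l.
rewrite -rmorphM -fmorphV -rmorphM lecR.
by rewrite le_eqVlt; apply/orP; left; apply/eqP; field; rewrite gt_eqF.
Qed.

(** Differentiation under the integral: [L] is the candidate, and the error of the difference
    quotient is shown to be linear in |h|. *)
Lemma cauchy_transform_derivable z : ~ segment R p z -> derivable G z 1.
Proof.
move=> zs; have [d d0 dz] := dist_segment zs.
pose L := density_mean (fun t => - (z - (xcoord m t)%:C)^-1 ^+ 2).
apply: (cvgP L).
apply/(@cvgrPdist_le _ _ _ _ (dnbhs_filter 0)) => e /complex_gt0P[e' e0 ->].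
(* With |z - x| >= d and |z + h - x| >= d / 2, the error integrand [g] below is at most B |h|. *)
pose B := 2 / d ^+ 3.
have B0 : 0 < B by rewrite divr_gt0// exprn_gt0.
(* The first bound keeps z + h at distance d / 2 from the segment; the second makes 2 B |h| at most
   e'. *)
pose dl := Num.min (d / 2) (e' / (2 * B)).
have dl0 : 0 < dl by rewrite lt_min !divr_gt0// mulr_gt0.
near=> h.
have h0 : h != 0 by near: h; exact: nbhs_dnbhs_neq.
have hd : `|h| < dl%:C by near: h; apply: dnbhs0_lt; rewrite ltcR.
have nh : `|h| = (Re `|h|)%:C by rewrite normc_def.
have : Re `|h| < dl by rewrite -ltcR -nh.
rewrite lt_min => /andP[hd1 hd2].
have far w : segment R p w -> (d / 2)%:C <= `|z + h - w|.
  move=> /dz dzw; have : `|z - w| <= `|z + h - w| + `|h|.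
    by apply: le_trans (ler_normB _ _); rewrite le_eqVlt; apply/orP; left; apply/eqP; congr (`|_|); ring.
  rewrite nh -lerBlDr; apply: le_trans.
  apply: le_trans (lerB dzw (lexx _)); rewrite -rmorphB lecR.
  lra.
have zhs : ~ segment R p (z + h).
  by move=> /[dup] sw /far; rewrite subrr normr0 lecR leNgt divr_gt0.
pose g t := - h / ((z - (xcoord m t)%:C) ^+ 2 * (z + h - (xcoord m t)%:C)).
have gc : ccontinuous_on (- c0) c0 g.
  move=> t tI; apply: ccontinuousM; first exact: ccontinuous_cst.
  apply: ccontinuousV; first by rewrite mulf_neq0 ?expf_neq0 ?sub_neq0.
  by apply: ccontinuousM; [apply: ccontinuousX|]; exact: sub_cont.
have -> : L - h^-1 *: (G (h *: 1 + z) - G z) = density_mean g.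
  rewrite [h *: 1]mulr1 [h + z]addrC !cauchy_transform_mean// /L.
  pose a t := (z - (xcoord m t)%:C)^-1.
  pose b t := (z + h - (xcoord m t)%:C)^-1.
  have ac : ccontinuous_on (- c0) c0 a by exact: subV_cont.
  have bc : ccontinuous_on (- c0) c0 b by exact: subV_cont.
  have acn : ccontinuous_on (- c0) c0 (fun t => - a t ^+ 2).
    by move=> t tI; apply: ccontinuousN; apply: ccontinuousX; exact: ac.
  have hc (k : R -> R[i]) c : ccontinuous_on (- c0) c0 k ->
      ccontinuous_on (- c0) c0 (fun t => c * k t).
    by move=> kc t tI; apply: ccontinuousM; [exact: ccontinuous_cst|exact: kc].
  transitivity (density_mean (fun t => - a t ^+ 2 + (- h^-1 * b t + h^-1 * a t))).
    rewrite (density_meanD acn); last first.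
      by move=> t tI; apply: ccontinuousD; [exact: (hc b)|exact: (hc a)].
    rewrite (density_meanD (hc b _ bc) (hc a _ ac)) (density_meanZ _ ac) (density_meanZ _ bc).
    by rewrite /GRing.scale /=; ring.
  apply: eq_cintegral => t tI; congr (_ * _); rewrite /g /a /b.
  by field; rewrite h0 !sub_neq0.
apply: le_trans (density_mean_bound (B := B * Re `|h|) gc _) _; last first.
  rewrite lecR; move: hd2; have B2 : 0 < 2 * B by exact: mulr_gt0.
  rewrite (ltr_pdivlMr _ _ B2) => /ltW; apply: le_trans.
  by rewrite le_eqVlt; apply/orP; left; apply/eqP; ring.
move=> t tI; rewrite /g normrM normrN normfV normrM normrX.
have -> : (B * Re `|h|)%:C = `|h| * B%:C by rewrite [RHS]mulrC [in RHS]nh -rmorphM.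
apply: ler_wpM2l => //.
have -> : B = (d ^+ 2 * (d / 2))^-1 by rewrite /B; field; rewrite gt_eqF.
have d1 : 0 < d%:C by rewrite ltcR.
have d2 : 0 < (d / 2)%:C by rewrite ltcR divr_gt0.
have n1 := dz _ (xsegment tI); have n2 := far _ (xsegment tI).
rewrite fmorphV lef_pV2 ?posrE; last 2 first.
- by rewrite mulr_gt0 ?exprn_gt0//; [exact: lt_le_trans n1|exact: lt_le_trans n2].
- by rewrite ltcR mulr_gt0 ?exprn_gt0 ?divr_gt0.
rewrite rmorphM rmorphXn ler_pM ?exprn_ge0 ?(ltW d1) ?(ltW d2)//.
by rewrite lerXn2r ?nnegrE ?(ltW d1).
Unshelve. all: by end_near.
Qed.

End cauchy_transform_regularity.

(** * Support *)

Section support.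
Variables (R : realType) (m r : nat).
Hypotheses (m_gt0 : (0 < m)%N) (r_lt : (r < m.+1)%N).
Local Notation p := m.+1.
Local Notation leb := (@lebesgue_measure R).
Local Notation c0 := (arc_end R m).
Local Notation I := (`[- c0, c0]%classic : set R).
Local Notation mu := (@raney_measure R m r m_gt0 r_lt).

Let subI t : 0 <= t <= c0 -> - c0 <= t <= c0.
Proof. by move=> /andP[t0 ->]; rewrite andbT (le_trans _ t0)// oppr_le0 ltW// arc_end_gt0. Qed.

Let xcoordC_cont t : - c0 <= t <= c0 ->
  {for t, continuous (fun s => (xcoord m s)%:C : R[i])}.
Proof.
move=> tI; apply: (continuous_comp (f := xcoord m)).
  exact: xcoord_continuous.
exact: continuous_real_complex.
Qed.

(** Positivity of the density is available only for 0 < t < [c0]; by continuity of [xcoord] an end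
    parameter can be moved inwards without leaving U. *)
Lemma interior_point (U : set R[i]) t : open U -> 0 <= t <= c0 -> U (xcoord m t)%:C ->
  exists2 s, 0 < s < c0 & U (xcoord m s)%:C.
Proof.
move=> oU tI Ut.
have : \forall s \near t, U (xcoord m s)%:C.
  by apply: (xcoordC_cont (subI tI)); apply: open_nbhs_nbhs; split.
move=> /nbhs_ballP[e /= e0 eU]; have c_gt0 := arc_end_gt0 R m.
have /andP[t0 tc] := tI.
pose d := Num.min (e / 2) (c0 / 2).
have d0 : 0 < d by rewrite lt_min; apply/andP; split; lra.
have de : d < e by rewrite gt_min ltr_pdivrMr// mulr_natr mulr2n ltrDl e0.
have dc : d <= c0 / 2 by rewrite ge_min lexx orbT.
(* The parameter moves to the right in the left half of the interval and to the left in the right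
   half. *)
have [th|th] := leP t (c0 / 2).
  exists (t + d / 2); first by apply/andP; split; lra.
  by apply: eU; rewrite -ball_normE /= opprD addNKr normrN gtr0_norm; lra.
exists (t - d / 2); first by apply/andP; split; lra.
by apply: eU; rewrite -ball_normE /= opprB addrC subrK gtr0_norm; lra.
Qed.

(** By continuity there is an interval [t, b] that [xcoord] maps into U and on which the density
    exceeds half its value at t. *)
Lemma raney_measure_gt0 (U : set R[i]) t : open U -> 0 < t < c0 -> U (xcoord m t)%:C ->
  (0 < mu U)%E.
Proof.
move=> oU tI Ut; have /andP[t0 tc] := tI.
have tI' : - c0 <= t <= c0 by apply: subI; rewrite !ltW.
have dt := density_gt0 m_gt0 r_lt tI.
have xU : \forall s \near t, U (xcoord m s)%:C.
  by apply: (xcoordC_cont tI'); apply: open_nbhs_nbhs; split.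
have dU : \forall s \near t, density m r t / 2 < density m r s.
  apply: (cvgr_gt _ (@density_continuous _ _ m_gt0 r _ tI')); lra.
have [e /= e0 eU] : exists2 e : R, 0 < e & forall s, `|t - s| < e ->
    U (xcoord m s)%:C /\ density m r t / 2 < density m r s.
  have : nbhs t [set s | U (xcoord m s)%:C /\ density m r t / 2 < density m r s].
    exact: (filterI xU dU).
  move=> /nbhs_ballP[e /= e0 eU].
  by exists e => // s ts; exact: eU.
pose b := t + Num.min (e / 2) ((c0 - t) / 2).
have b1 : t < b by rewrite ltrDl lt_min; apply/andP; split; lra.
have b2 : b - t < e.
  by rewrite addrAC subrr add0r gt_min ltr_pdivrMr// mulr_natr mulr2n ltrDl e0.
have b3 : b < c0.
  have : b - t <= (c0 - t) / 2 by rewrite addrAC subrr add0r ge_min lexx orbT.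
  by move: b1; lra.
have tbU s : t <= s <= b -> U (xcoord m s)%:C /\ density m r t / 2 < density m r s.
  by move=> /andP[s1 s2]; apply: eU; rewrite distrC ger0_norm; lra.
have sub : `[t, b]%classic `<=` raney_point m @^-1` U.
  move=> s; rewrite /= in_itv/= => sI; rewrite /raney_point patchE mem_set; last first.
    by rewrite /= in_itv/=; apply: subI; move: sI => /andP[s1 s2]; apply/andP; split; lra.
  by have [] := tbU _ sI.
suff : (0 < \int[leb]_(s in raney_point m @^-1` U) ((density m r \_ I) s)%:E)%E by [].
apply: (@lt_le_trans _ _ (\int[leb]_(s in `[t, b]) (density m r t / 2)%:E)%E).
  rewrite integral_cst//= lebesgue_measure_itv/= lte_fin b1 -EFinB -EFinM lte_fin.
  by apply: mulr_gt0; lra.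
have mX : measurable (raney_point m @^-1` U : set (measurableTypeR R)).
  have := @measurable_raney_point R m m_gt0 measurableT _ (open_measurable_complex oU).
  by rewrite setTI.
have mf : measurable_fun [set: R] (EFin \o (density m r \_ I)).
  by apply/measurable_EFinP; exact: (pdf_measurable (@raney_pdf R m r m_gt0 r_lt)).
have f0 s : (0 <= ((density m r \_ I) s)%:E)%E.
  by rewrite lee_fin; exact: (pdf_ge0 (@raney_pdf R m r m_gt0 r_lt)).
apply: (@le_trans _ _ (\int[leb]_(s in `[t, b]) ((density m r \_ I) s)%:E)%E).
  apply: ge0_le_integral => //=.
  - by move=> s _; rewrite lee_fin; lra.
  - exact: measurable_funTS.
  - move=> s; rewrite /= in_itv/= => sI; rewrite lee_fin patchE mem_set.
      by rewrite ltW//; have [] := tbU _ sI.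
    by rewrite /= in_itv/=; apply: subI; move: sI => /andP[s1 s2]; apply/andP; split; lra.
apply: ge0_subset_integral => //=.
exact: measurable_funTS.
Qed.

Lemma msupport_raney : msupport mu = segment R p.
Proof.
apply/seteqP; split=> z.
  apply: contraPP => zs /(_ (~` segment R p)) h.
  have : (0 < mu (~` segment R p))%E.
    by apply: h => //; apply: closed_openC; exact: complex_segment_closed.
  change (0 < \int[leb]_(s in raney_point m @^-1` (~` segment R p)) ((density m r \_ I) s)%:E -> False)%E.
  (* All values of [raney_point] are on the segment, so its complement is null and no point outside
     is in the support. *)
  rewrite (_ : _ @^-1` _ = set0) ?integral_set0 ?ltxx//.
  by apply/seteqP; split=> // t /=; apply; exact: raney_point_segment.
move=> [k /=]; rewrite in_itv/= => /(xcoord_surj m_gt0)[t tI <-] <- U oU Ut.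
have [s sI Us] := interior_point oU tI Ut.
exact: raney_measure_gt0 sI Us.
Qed.

End support.

(** * The segment is a semianalytic arc *)

Section semianalytic_segment.
Variable R : realType.
Local Notation Re := (@complex.Re R).
Local Notation Im := (@complex.Im R).

Lemma real_analytic_affine (f : R[i] -> R) (k b d : R) (z : R[i]) :
  (forall w, f w = k + b * Re w + d * Im w) -> real_analytic_at f z.
Proof.
move=> fE.
(* The Taylor coefficients at z; as only those of degree at most 1 survive, the partial sums are
   constant from n = 2 on and radius 1 will do. *)
pose c (i j : nat) : R := match i, j with
  | 0%N, 0%N => f z | 1%N, 0%N => b | 0%N, 1%N => d | _, _ => 0 end.
exists c, 1, (`|f z| + `|b| + `|d|); split => //.
  have := normr_ge0 (f z); have := normr_ge0 b; have := normr_ge0 d => h1 h2 h3.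
  move=> i j; rewrite expr1n mulr1.
  by case: i j => [|[|i]] [|[|j]] /=; rewrite ?normr0; lra.
move=> x y _ _; apply: cvg_near_cst; near=> n.
have n2 : (2 <= n)%N by near: n; exact: nbhs_infty_ge.
rewrite -(subnK n2) addn2; move: (n - 2)%N => {n2} k'.
have row0 : \sum_(j < k'.+2) c 0%N j * x ^+ 0 * y ^+ j = f z + d * y.
  rewrite !big_ord_recl big1 => [|j _]; last by rewrite /c /= !mul0r.
  by rewrite /c /= expr1 expr0; ring.
have row1 : \sum_(j < k'.+2) c 1%N j * x ^+ 1 * y ^+ j = b * x.
  rewrite big_ord_recl big1 => [|j _]; last by rewrite /c /= !mul0r.
  by rewrite /c /= expr1 expr0; ring.
have outer (F : nat -> R) :
    \sum_(i < k'.+2) F i = F 0%N + (F 1%N + \sum_(i < k') F i.+2).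
  by rewrite !big_ord_recl.
rewrite (outer (fun i => \sum_(j < k'.+2) c i j * x ^+ i * y ^+ j)) row0 row1.
rewrite big1 => [|i _]; last first.
  by apply: big1 => j _; rewrite /c /= !mul0r.
by rewrite !fE !ReD !ImD /=; ring.
Unshelve. all: by end_near. Qed.

Lemma semianalytic_segment p : semianalytic (segment R p).
Proof.
move=> z; pose K := Kedge R p.
(* Three pieces: k = 0 is the open segment (Im = 0, Re > 0, K - Re > 0), k = 1 the endpoint 0 and k
   = 2 the endpoint K, given by equations only. Repeated equations fill the third slot. *)
pose f (k l : 'I_3) (w : R[i]) : R :=
  if l == 0 :> nat then Im w else
  if k == 1 :> nat then Re w else
  if k == 2 :> nat then K - Re w else
  if l == 1 :> nat then Re w else K - Re w.
pose s (k l : 'I_3) := (k != 0 :> nat) || (l == 0 :> nat).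
exists setT, 3, 3, f, s; split => //.
- exact: openT.
- move=> k l w _; rewrite /f.
  have aI : real_analytic_at Im w.
    by apply: (@real_analytic_affine _ 0 0 1) => v; ring.
  have aR : real_analytic_at Re w.
    by apply: (@real_analytic_affine _ 0 1 0) => v; ring.
  have aK : real_analytic_at (fun v => K - Re v) w.
    by apply: (@real_analytic_affine _ K (-1) 0) => v; ring.
  by move: (l == 0%N :> nat) (k == 1%N :> nat) (k == 2 :> nat) (l == 1%N :> nat) => [] [] [] [].
- rewrite setIT; apply/seteqP; split=> w.
    move=> /segmentP[iw /andP[]]; rewrite -/K.
    rewrite le_eqVlt => /predU1P[r0 _|r0].
      split => //; exists (inord 1) => l; rewrite /s /f !inordK//=.
      by case: ifP => // _; rewrite -r0.
    rewrite le_eqVlt => /predU1P[rK|rK].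
      split => //; exists (inord 2) => l; rewrite /s /f !inordK//=.
      by case: ifP => // _; rewrite rK subrr.
    split => //; exists (inord 0) => l; rewrite /s /f !inordK//=.
    by case: (l == 0%N :> nat) => //; case: (l == 1%N :> nat); rewrite ?subr_gt0.
  move=> [_ [k fk]]; apply/segmentP.
  have K0 : 0 <= K by rewrite divr_ge0// exprn_ge0.
  have := fk (inord 0); have := fk (inord 1); have := fk (inord 2).
  rewrite /s /f !inordK//= orbT -/K.
  case: (k : nat) (ltn_ord k) => [|[|[|//]]] _ /=; rewrite ?subr_gt0 => h1 h2 h3.
  + by split => //; rewrite !ltW.
  + by split => //; rewrite h1 lexx.
  + by split => //; rewrite (_ : Re w = K) ?lexx ?K0//; lra.
Qed.

Lemma arcs_segment p : 0 < Kedge R p -> arcs_and_isolated_points (segment R p).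
Proof.
move=> K0; exists 1%N, (fun=> segment R p), [::]; split=> //.
- move=> _; split; first exact: semianalytic_segment.
  exists (fun t => (Kedge R p * t)%:C); split.
  + apply: continuous_subspaceT => t.
    apply: (continuous_comp (f := fun t => Kedge R p * t)); last exact: continuous_real_complex.
    exact: mulrl_continuous.
  + by move=> s t _ _ [] /(mulfI (lt0r_neq0 K0)).
  + apply/seteqP; split=> [_ [x /= xI <-]|_ [t /= tI <-]].
      exists (x / Kedge R p); last by rewrite mulrC divfK ?lt0r_neq0.
      move: xI; rewrite /= !in_itv/= => /andP[x0 xK].
      by rewrite divr_ge0 ?(ltW K0)//= ler_pdivrMr// mul1r.
    exists (Kedge R p * t) => //; move: tI; rewrite /= !in_itv/= => /andP[t0 t1].
    by rewrite mulr_ge0 ?(ltW K0)//= ger_pMr.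
- rewrite (_ : [set` [::]] = set0) ?setU0; last by apply/seteqP; split => // z.
  by apply/seteqP; split=> [z sz|z [k _]//]; exists ord0.
Qed.

End semianalytic_segment.

(** * The resultant and its irreducible factors *)

Section resultant_annihilates.
Variables (R : realType) (p r : nat).
Hypotheses (p_gt1 : (1 < p)%N) (r_gt0 : (0 < r)%N).

Local Notation trinomialU :=
  ('X^p - ('X : {poly {poly R[i]}})%:P * 'X + ('X : {poly {poly R[i]}})%:P).

Lemma size_trinomial (A : nzRingType) (a b : A) :
  size ('X^p - a%:P * 'X + b%:P) = p.+1.
Proof.
rewrite -addrA size_polyDl size_polyXn// (leq_ltn_trans (size_polyD _ _))//.
rewrite gtn_max size_polyN (leq_ltn_trans (size_polyC_leq1 _)) ?andbT//; last exact: ltnW.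
rewrite mul_polyC (leq_ltn_trans (size_scale_leq _ _))// size_polyX.
by rewrite ltnS.
Qed.

(** The resultant lies in the ideal generated by the two polynomials, so it vanishes wherever they
    have a common root. *)
Lemma raney_resultant_root (z w u : R[i]) :
  u ^+ p - z * u + z = 0 -> u ^+ r = z * w -> (raney_resultant R p r).[z, w] = 0.
Proof.
move=> hu hr; rewrite /raney_resultant.
have s1 : (1 < size trinomialU)%N by rewrite size_trinomial ltnS ltnW.
have s2 : (1 < size ('X^r - ('X * 'X%:P : {poly {poly R[i]}})%:P)%R)%N.
  by rewrite size_XnsubC// ltnS.
have [[A B] _ /(congr1 (fun F => F.[u%:P%:P].[z%:P].[w]))] := resultant_in_ideal s1 s2.
rewrite hornerC => ->; rewrite !(hornerE, hornerXn) /=.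
by rewrite hu hr subrr !mulr0 addr0.
Qed.

(** At z = 1, w = 0 the polynomials become u ^ p - u + 1 and u ^ r, which are coprime. Both are
    monic in u, so the resultant commutes with this specialization. *)
Lemma raney_resultant_neq0 : raney_resultant R p r != 0.
Proof.
have [ev evX evC] : exists2 ev : {rmorphism {poly {poly R[i]}} -> R[i]},
    ev 'X = 1 & ev 'X%:P = 0.
  exists (horner_eval (0 : R[i]) \o horner_eval (1%:P : {poly R[i]})).
    by rewrite /= /horner_eval hornerX hornerC.
  by rewrite /= /horner_eval hornerC hornerX.
have mt : map_poly ev trinomialU = 'X^p - 1%:P * 'X + 1%:P.
  by rewrite rmorphD rmorphB rmorphM /= map_polyXn !map_polyC map_polyX /= evX.
have mw : map_poly ev ('X^r - ('X * 'X%:P : {poly {poly R[i]}})%:P) = 'X^r.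
  by rewrite rmorphB /= map_polyXn map_polyC /= rmorphM /= evC mulr0 polyC0 subr0.
have mon : lead_coef trinomialU = 1.
  apply/monicP; rewrite monicE /lead_coef size_trinomial /=.
  rewrite !coefD coefXn eqxx coefN coefCM coefX coefC.
  by rewrite !gtn_eqF ?(ltnW p_gt1)// mulr0 subr0 addr0.
have lw : lead_coef ('X^r - ('X * 'X%:P : {poly {poly R[i]}})%:P) = 1.
  by apply/eqP; rewrite -monicE monicXnsubC.
apply/negP => /eqP /(congr1 ev); rewrite rmorph0 /raney_resultant.
rewrite (map_resultant (f := ev)) ?mon ?lw ?rmorph1 ?oner_eq0// mt mw.
move=> /eqP; apply/negP; rewrite resultant_eq0 -leqNgt.
have : coprimep ('X^p - 1%:P * 'X + 1%:P : {poly R[i]}) 'X^r.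
  apply: coprimep_expr; set F := _ + 1%:P.
  have := coprimep_XsubC F 0; rewrite subr0 coprimep_sym => ->.
  rewrite /root /F !hornerE expr0n gtn_eqF ?(ltnW p_gt1)//= subrr add0r.
by rewrite /coprimep => /eqP ->.
Qed.

End resultant_annihilates.

(** * Vanishing along the branch and irreducible factors *)

Section rational_parametrization.
Variables (R : realType) (p r : nat) (D : set R[i]) (u G : R[i] -> R[i]).
Hypothesis D_infty : near_infinity D.
Hypothesis u_neq0 : forall z, D z -> u z != 0.
Hypothesis u_neq1 : forall z, D z -> u z - 1 != 0.
Hypothesis u_param : forall z, D z -> z = u z ^+ p / (u z - 1).
Hypothesis G_param : forall z, D z -> G z = u z ^+ r / z.
Implicit Types P Q : {poly {poly R[i]}}.

(* h agrees, away from 0 and 1, with a rational function with poles at 0 and 1 only. *)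
Definition regular (h : R[i] -> R[i]) : Prop :=
  exists (N : {poly R[i]}) (k : nat),
    forall x, x != 0 -> x - 1 != 0 -> N.[x] = (x * (x - 1)) ^+ k * h x.

Lemma regular_cst c : regular (fun=> c).
Proof. by exists c%:P, 0%N => x _ _; rewrite hornerC expr0 mul1r. Qed.

Lemma regularD h g : regular h -> regular g -> regular (fun x => h x + g x).
Proof.
move=> [N [k hN]] [M [l gM]].
exists ((('X * ('X - 1%:P)) ^+ l) * N + (('X * ('X - 1%:P)) ^+ k) * M), (k + l)%N.
move=> x x0 x1; rewrite !(hornerE, horner_exp) hN// gM// exprD; ring.
Qed.

Lemma regularM h g : regular h -> regular g -> regular (fun x => h x * g x).
Proof.
move=> [N [k hN]] [M [l gM]]; exists (N * M), (k + l)%N.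
by move=> x x0 x1; rewrite hornerM hN// gM// exprD; ring.
Qed.

Let Z x : R[i] := x ^+ p / (x - 1).
Let W x : R[i] := x ^+ r / Z x.

Lemma regularZ : regular Z.
Proof.
exists ('X^(p.+1)), 1%N => x x0 x1; rewrite hornerXn /Z [x ^+ p.+1]exprS expr1.
by move: (x ^+ p) => a; field.
Qed.

Lemma regularW : regular W.
Proof.
exists ('X^r * ('X - 1%:P) ^+ p.+1), p => x x0 x1.
rewrite hornerM !horner_exp hornerX hornerXsubC /W /Z exprMn [(x - 1) ^+ p.+1]exprS.
have := expf_neq0 p x0.
by move: (x ^+ p) (x ^+ r) ((x - 1) ^+ p) => a b c a0; field; rewrite x1.
Qed.

Lemma regular_horner P : regular (fun x => P.[Z x, W x]).
Proof.
have inner (c : {poly R[i]}) : regular (fun x => c.[W x]).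
  elim/poly_ind: c => [|c k ih].
    have := regular_cst 0; congr regular; apply/funext => x.
    by rewrite horner0.
  have := regularD (regularM ih regularW) (regular_cst k).
  by congr regular; apply/funext => x; rewrite !hornerE.
elim/poly_ind: P => [|P c ih].
  have := regular_cst 0; congr regular; apply/funext => x.
  by rewrite !horner0.
have := regularD (regularM ih regularZ) (inner c).
by congr regular; apply/funext => x; rewrite !hornerE.
Qed.

(* The points u z for z large are infinitely many. *)
Lemma poly_vanishing (N : {poly R[i]}) :
  near_infinity (fun z => D z -> N.[u z] = 0) -> N = 0.
Proof.
move=> [M NM]; have [M' DM'] := D_infty.
(* Distinct real points beyond both thresholds, hence in D and in the range where N vanishes. *)
pose x (k : nat) : R[i] := (`|M| + `|M'| + 1 + k%:R)%:C.
have xM k (B : R) : B <= `|M| + `|M'| -> B%:C < `|x k|.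
  move=> BM; rewrite /x normc_def /= expr0n addr0 sqrtr_sqr ltcR.
  have := ler0n R k; have := normr_ge0 M; have := normr_ge0 M' => h1 h2 h3.
  by rewrite ger0_norm; lra.
have Dx k : D (x k).
  apply: DM'; apply: xM; have := ler_norm M'; have := normr_ge0 M; lra.
apply/eqP; apply: contraT => N0.
have := max_poly_roots N0 (rs := [seq u (x k) | k <- iota 0 (size N)]).
rewrite size_map size_iota ltnn => -> //.
  apply/allP => _ /mapP[k _ ->]; apply/eqP/NM => //; apply: xM.
  have := ler_norm M; have := normr_ge0 M'; lra.
(* By [u_param] z is recovered from u z, so distinct points give distinct roots, one more than the
   degree allows. *)
rewrite map_inj_uniq ?iota_uniq// => k l kl.
have := u_param (Dx k); rewrite kl -u_param// => -[] /addrI/eqP.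
by rewrite eqr_nat => /eqP.
Qed.

(** Along the branch each factor is a polynomial in u, up to powers of u (u - 1). The product of the
    two numerators has infinitely many roots, so one numerator is zero and its factor vanishes on
    all of D, not only near infinity. *)
Lemma vanishing_mul P Q :
  near_infinity (fun z => (P * Q).[z, G z] = 0) ->
  (forall z, D z -> P.[z, G z] = 0) \/ (forall z, D z -> Q.[z, G z] = 0).
Proof.
move=> [M PQ].
have [N [k NP]] := regular_horner P; have [N' [k' NQ]] := regular_horner Q.
have val z T : D z -> T.[z, G z] = T.[Z (u z), W (u z)].
  by move=> Dz; rewrite /W /Z -(u_param Dz) -(G_param Dz).
have : N * N' = 0.
  apply: poly_vanishing; exists M => z zM Dz.
  rewrite hornerM NP ?u_neq0 ?u_neq1// NQ ?u_neq0 ?u_neq1// mulrACA -!val//.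
  by rewrite -hornerM -hornerM PQ ?mulr0.
have zero T N1 k1 : (forall x, x != 0 -> x - 1 != 0 ->
     N1.[x] = (x * (x - 1)) ^+ k1 * T.[Z x, W x]) -> N1 = 0 ->
   forall z, D z -> T.[z, G z] = 0.
  move=> NT N0 z Dz; have /esym/eqP := NT _ (u_neq0 Dz) (u_neq1 Dz).
  rewrite N0 horner0 mulf_eq0 expf_eq0 mulf_eq0.
  by rewrite (negbTE (u_neq0 Dz)) (negbTE (u_neq1 Dz)) andbF /= -val// => /eqP.
move=> /eqP; rewrite mulf_eq0 => /orP[]/eqP N0; [left|right].
  exact: zero NP N0.
exact: zero NQ N0.
Qed.

(** Applying [vanishing_mul] to P * P carries the vanishing from infinity to the whole of D. *)
Lemma vanishing_off P : near_infinity (fun z => P.[z, G z] = 0) ->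
  forall z, D z -> P.[z, G z] = 0.
Proof.
move=> [M PM]; have PP : near_infinity (fun z => (P * P).[z, G z] = 0).
  by exists M => z zM; rewrite !hornerM PM ?mulr0.
by have [] := vanishing_mul PP.
Qed.

Lemma unit2P P : P != 0 -> (size P <= 1)%N -> (sizeY P <= 1)%N -> P \is a GRing.unit.
Proof.
move=> P0 sP yP; have /size1_polyC Pc := sP.
have c0 : P`_0 != 0 by apply: contra P0 => /eqP c0; rewrite Pc c0.
have sc : (size (P`_0)%R <= 1)%N by apply: leq_trans yP; exact: max_size_coefXY.
have /size1_polyC cc := sc.
rewrite poly_unitE eqn_leq sP size_poly_gt0 P0 /= poly_unitE eqn_leq sc.
rewrite size_poly_gt0 c0 /= unitfE; apply: contra c0 => /eqP d0.
by rewrite cc d0.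
Qed.

(** Induction on the total of the sizes in the two variables. In a factorization into nonunits,
    [vanishing_mul] finds a factor vanishing along the branch, and its total is smaller. *)
Lemma irreducible_factor (n : nat) P : (size P + sizeY P <= n)%N -> P != 0 ->
  near_infinity (fun z => P.[z, G z] = 0) ->
  exists2 Q, divides2 Q P & defining_polynomial G Q.
Proof.
elim: n P => [|n ih] P Pn P0 VP.
  by move: Pn; rewrite leqn0 addn_eq0 size_poly_eq0 (negbTE P0).
have nunit Q : near_infinity (fun z => Q.[z, G z] = 0) -> Q \isn't a GRing.unit.
  move=> [M QM]; apply/negP; rewrite poly_unitE => /andP[/eqP s1 c1].
  have Qc : Q = (Q`_0)%:P by apply: size1_polyC; rewrite s1.
  move: c1; rewrite poly_unitE => /andP[/eqP s2].
  have cc : Q`_0 = (Q`_0`_0)%:P by apply: size1_polyC; rewrite s2.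
  have xM : M%:C < `|(`|M| + 1)%:C : R[i]|.
    by rewrite normc_def /= expr0n addr0 sqrtr_sqr ltcR ger0_norm ?addr_ge0// ltr_pwDr// ler_norm.
  move=> u0; have := QM _ xM; rewrite Qc cc !hornerC => /eqP; apply/negP.
  by rewrite -unitfE.
have [irr|nirr] := pselect (irreducible2 P).
  by exists P => //; exists 1; rewrite mulr1.
have [A [B [PAB nA nB]]] : exists A B, [/\ P = A * B, A \isn't a GRing.unit & B \isn't a GRing.unit].
  apply: contrapT => none; apply: nirr; split => //; first exact: nunit.
  move=> A B PAB; apply: contrapT => /not_orP[/negP nA /negP nB].
  by apply: none; exists A, B.
have reduce A' B' : P = A' * B' -> B' \isn't a GRing.unit ->
   (forall z, D z -> A'.[z, G z] = 0) -> exists2 Q, divides2 Q P & defining_polynomial G Q.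
  move=> PE nB' VA.
  have /andP[A0 B0] : (A' != 0) && (B' != 0) by rewrite -negb_or -mulf_eq0 -PE.
  have [|//||Q [C AE] defQ] := ih A'.
  (* A nonzero polynomial of size 1 in both variables is a unit. Sizes add up to one less in each
     variable, so a total above 2 for B' makes that of A' drop. *)
  - have sB : (2 < size B' + sizeY B')%N.
      rewrite ltnNge; apply: contra nB' => sB.
      have b1 : (0 < size B')%N by rewrite size_poly_gt0.
      have b2 : (0 < sizeY B')%N by rewrite lt0n sizeY_eq0.
      by apply: unit2P => //; lia.
    have sP : size P = (size A' + size B').-1 by rewrite PE size_mul.
    have yP : sizeY P = (sizeY A' + sizeY B').-1.
      by rewrite !sizeYE PE rmorphM /= size_mul// swapXY_eq0.
    have a1 : (0 < size A')%N by rewrite size_poly_gt0.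
    have a2 : (0 < sizeY A')%N by rewrite lt0n sizeY_eq0.
    have b1 : (0 < size B')%N by rewrite size_poly_gt0.
    have b2 : (0 < sizeY B')%N by rewrite lt0n sizeY_eq0.
    lia.
  - by have [M' DM'] := D_infty; exists M' => z /DM'; exact: VA.
  - by exists Q => //; exists (C * B'); rewrite PE AE mulrA.
rewrite PAB in VP.
have [VA|VB] := vanishing_mul VP; first exact: reduce PAB nB VA.
by apply: reduce nA VB; rewrite mulrC.
Qed.

End rational_parametrization.

(** * The family of measures and its mother-body property *)

Lemma segment0 (R : realType) p : segment R p 0.
Proof. by apply/segmentP; rewrite /= lexx divr_ge0// exprn_ge0. Qed.

Lemma raney_branch (R : realType) (m : nat) (m_gt0 : (0 < m)%N) (z : R[i]) :
  ~ segment R m.+1 z ->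
  exists2 b : R[i], b ^+ m.+1 - z * b + z = 0 &
    forall r (r_lt : (r < m.+1)%N),
      cauchy_transform (raney_measure R m_gt0 r_lt) z = b ^+ r.+1 / z.
Proof.
move=> zs; have [b hb hG] := cauchy_density m_gt0 zs.
by exists b => // r r_lt; rewrite cauchy_transform_raney.
Qed.

Theorem proposition8p3 (R : realType) (p : nat) (hp : (2 <= p)%N) :
  exists mu : nat -> probability (borelC R) R,
    let G (r : nat) := cauchy_transform (mu r) in
    forall r : nat, (1 <= r <= p)%N ->
    [/\ mu r (segment R p) = 1%E /\ algebraic_on (~` segment R p) (G r),
        forall z : R[i], ~ segment R p z ->
          let u := z * G 1%N z in
          u ^+ p - z * u + z = 0 /\ u ^+ r = z * G r z,
        forall z : R[i], ~ segment R p z ->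
          (raney_resultant R p r).[z, G r z] = 0,
        leading_term (G r) 1
      & let branch_factor (P : {poly {poly R[i]}}) :=
          divides2 P (raney_resultant R p r) /\ defining_polynomial (G r) P in
        (exists P, branch_factor P) /\
        (forall P, branch_factor P -> positive_mother_body (G r) P (mu r))].
Proof.
case: p hp => [|m]// m_gt0; rewrite ltnS in m_gt0.
(* [raney_measure] takes a proof of r < p, so a family over all of nat is obtained by choice;
   indices outside 1, ..., p receive mu_{p,1} as a default. *)
have [mu muE] : exists mu : nat -> probability (borelC R) R,
    forall r (r_lt : (r < m.+1)%N), mu r.+1 = raney_measure R m_gt0 r_lt.
  have : forall n, exists nu : probability (borelC R) R,
      forall r (r_lt : (r < m.+1)%N), n = r.+1 -> nu = raney_measure R m_gt0 r_lt.
    case=> [|r]; first by exists (raney_measure R m_gt0 (ltn0Sn m)).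
    have [r_lt|r_ge] := boolP (r < m.+1)%N.
      by exists (raney_measure R m_gt0 r_lt) => k k_lt [rk]; subst k; congr raney_measure; exact: bool_irrelevance.
    by exists (raney_measure R m_gt0 (ltn0Sn m)) => k k_lt [rk]; rewrite rk k_lt in r_ge.
  by move=> /choice[mu muP]; exists mu => r r_lt; exact: muP.
exists mu => G [//|r] /andP[_ r_lt]; rewrite ltnS in r_lt.
have z_neq0 z : ~ segment R m.+1 z -> z != 0.
  by move=> zs; apply/eqP => z0; apply: zs; rewrite z0; exact: segment0.
(* The root [b] is common to all indices; index 1 identifies it as z G_{p,1}(z), and index r + 1
   then gives the power. *)
have branchG z : ~ segment R m.+1 z ->
    let u := z * G 1%N z in u ^+ m.+1 - z * u + z = 0 /\ u ^+ r.+1 = z * G r.+1 z.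
  move=> zs; have [b hb bG] := raney_branch m_gt0 zs; have z0 := z_neq0 z zs.
  have -> : z * G 1%N z = b by rewrite /G muE bG expr1 mulrC divfK.
  by split => //; rewrite /G muE bG mulrC divfK.
have resG z : ~ segment R m.+1 z -> (raney_resultant R m.+1 r.+1).[z, G r.+1 z] = 0.
  by move=> zs; have [hu hr] := branchG z zs; apply: raney_resultant_root hu hr.
have GE : G r.+1 = cauchy_transform (raney_measure R m_gt0 r_lt) by rewrite /G muE.
have res0 : raney_resultant R m.+1 r.+1 != 0 by exact: raney_resultant_neq0.
pose u z := z * G 1%N z; pose D := ~` segment R m.+1.
have u0 z : D z -> u z != 0.
  move=> zs; have [/eqP hu _] := branchG z zs; apply: contraTneq hu.
  by rewrite -/(u z) => ->; rewrite expr0n mulr0 subr0 add0r z_neq0.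
have u1 z : D z -> u z - 1 != 0.
  move=> zs; have [/eqP hu _] := branchG z zs; apply: contraTneq hu => /eqP.
  by rewrite subr_eq0 -/(u z) => /eqP ->; rewrite expr1n mulr1 subrK oner_neq0.
have uz z : D z -> z = u z ^+ m.+1 / (u z - 1).
  move=> zs; have [hu _] := branchG z zs; rewrite -/(u z) in hu.
  by apply: (mulIf (u1 z zs)); rewrite divfK ?u1//; apply/eqP; rewrite eq_sym -subr_eq0 -hu; apply/eqP; ring.
have uG z : D z -> G r.+1 z = u z ^+ r.+1 / z.
  move=> zs; have [_ hr] := branchG z zs; rewrite -/(u z) in hr.
  by rewrite hr mulrC mulKf// z_neq0.
have D_infty : near_infinity D.
  by exists (Kedge R m.+1) => z; exact: large_not_segment.
have near_res : near_infinity (fun z => (raney_resultant R m.+1 r.+1).[z, G r.+1 z] = 0).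
  by have [M DM] := D_infty; exists M => z /DM; exact: resG.
have lead : leading_term (G r.+1) 1 by rewrite GE; exact: leading_term_cauchy.
have derG z : D z -> derivable (G r.+1) z 1.
  by rewrite GE; exact: cauchy_transform_derivable.
have supp : msupport (mu r.+1) = segment R m.+1 by rewrite muE; exact: msupport_raney.
split => //.
- split; first by rewrite muE; exact: raney_measure_segment.
  by exists (raney_resultant R m.+1 r.+1).
- move=> branch_factor; split.
    have [P PR defP] := irreducible_factor D_infty u0 u1 uz uG (leqnn _) res0 near_res.
    by exists P.
  move=> P [_ defP]; split=> //.
    split; last by exists 1.
    by have [M DM] := D_infty; exists M => z /DM; exact: derG.
  rewrite supp; split.
  + exact: complex_segment_compact.
  + by exists 0.
  + by apply: arcs_segment; rewrite divr_gt0// exprn_gt0// ltr0n.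
  + move=> x Dx z /connected_component_sub Dz; split; first exact: derG.
    (* The polynomial P vanishes along G near infinity; this extends to the whole complement of the
       segment, which contains the component. *)
    exact: (vanishing_off D_infty u0 u1 uz uG defP.2).
Qed.
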